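(* Consider a 2-cell downlink network with BSs 1, 2, each with $N_t\ge2$ antennas, and one single-antenna user per cell. Channels $\mathbf{h}_{i,j}\in\mathbb{C}^{N_t}$ ($i,j\in\{1,2\}$) are mutually independent with i.i.d. $\mathcal{CN}(0,1)$ entries, and perfect channel knowledge is available at the BSs. Each BS $j$ selects $s_j\in\{BF,IC\}$ with precoder $\mathbf{f}_{j,s_j}$ as in the context. Given fixed (deterministic) received powers $P^r_{1,1},P^r_{1,2}>0$, define $$\mathrm{SINR}_1(s_1,s_2)=\frac{P^r_{1,1}|\mathbf{h}_{1,1}^*\mathbf{f}_{1,s_1}|^2}{1+P^r_{1,2}|\mathbf{h}_{1,2}^*\mathbf{f}_{2,s_2}|^2},\qquad R_1(s_1,s_2)=\mathbb{E}[\log_2(1+\mathrm{SINR}_1(s_1,s_2))].$$ Then $R_1(BF,BF)=R_I^{(2)}(P^r_{1,1},P^r_{1,2},N_t)$, $R_1(BF,IC)=R_{BF}(P^r_{1,1},N_t)$, $R_1(IC,IC)=R_{BF}(P^r_{1,1},N_t-1)$, and $R_1(IC,BF)=R_I^{(2)}(P^r_{1,1},P^r_{1,2},N_t-1)$.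
   Context: Precoders: $\mathbf{f}_{j,BF}=\mathbf{h}_{j,j}/\|\mathbf{h}_{j,j}\|$; for $IC$, BS $j$ cancels interference to the user of the other cell $k\neq j$: $\mathbf{f}_{j,IC}=\mathbf{w}/\|\mathbf{w}\|$ with $\mathbf{w}=\big(\mathbf{I}-\mathbf{h}_{k,j}\mathbf{h}_{k,j}^*/\|\mathbf{h}_{k,j}\|^2\big)\mathbf{h}_{j,j}$. Functions: for $\gamma>0$ and integer $M\ge1$, $R_{BF}(\gamma,M)=\log_2(e)\,e^{1/\gamma}\sum_{k=0}^{M-1}\frac{\Gamma(-k,1/\gamma)}{\gamma^k}$, where $\Gamma(s,x)=\int_x^\infty t^{s-1}e^{-t}dt$ is the upper incomplete gamma function; $R_I^{(2)}(\gamma_1,\gamma_2,M)=\log_2(e)\sum_{i=0}^{M-1}\sum_{l=0}^{i}\frac{\gamma_1^{\,l+1-i}}{\gamma_2(i-l)!}I_1\!\left(\frac1{\gamma_1},\frac{\gamma_1}{\gamma_2},i,l+1\right)$, with $I_1(a,b,m,n)=\int_0^\infty\frac{x^me^{-ax}}{(x+b)^n(x+1)}dx$. *)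

(* Defs.v *)
From HB Require Import structures.
From mathcomp Require Import all_boot all_order all_algebra.
From mathcomp Require Import all_classical all_reals all_analysis.
From mathcomp Require Import complex.

Set Implicit Arguments.
Unset Strict Implicit.
Unset Printing Implicit Defensive.

Import Order.TTheory GRing.Theory Num.Theory.
Local Open Scope classical_set_scope.
Local Open Scope ring_scope.

Section Defs.
Variable R : realType.

(* ---------- complex vectors in C^n (column vectors over R[i]) ---------- *)

(* |z|^2 for a complex number z *)
Definition abs2 (z : R[i]) : R := @complex.Re R z ^+ 2 + @complex.Im R z ^+ 2.

(* Hermitian inner product u^* v *)
Definition cdot n (u v : 'cV[R[i]]_n) : R[i] :=
  \sum_(k < n) ((u k 0)^*)%C * v k 0.

(* squared Euclidean norm ||u||^2 and norm ||u|| *)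
Definition csqnorm n (u : 'cV[R[i]]_n) : R := \sum_(k < n) abs2 (u k 0).
Definition cnorm n (u : 'cV[R[i]]_n) : R := Num.sqrt (csqnorm u).

(* u / ||u|| *)
Definition cnormalize n (u : 'cV[R[i]]_n) : 'cV[R[i]]_n :=
  ((cnorm u)^-1)%:C%C *: u.

(* BF precoder of BS j : h_{j,j} / ||h_{j,j}|| *)
Definition f_BF n (hjj : 'cV[R[i]]_n) := cnormalize hjj.

(* IC precoder of BS j, cancelling interference to the user of cell k:
   w = (I - h_{k,j} h_{k,j}^* / ||h_{k,j}||^2) h_{j,j},  f = w / ||w|| *)
Definition f_IC n (hkj hjj : 'cV[R[i]]_n) :=
  let P := 1%:M - ((csqnorm hkj)^-1)%:C%C *: (hkj *m (map_mx (@conjc R) hkj)^T) in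
  cnormalize (P *m hjj).

Inductive strategy := BF | IC.

(* precoder f_{j,s} of BS j given its own direct channel h_{j,j} and
   the channel h_{k,j} from BS j to the other cell's user k <> j *)
Definition precoder n (s : strategy) (hjj hkj : 'cV[R[i]]_n) :=
  match s with BF => f_BF hjj | IC => f_IC hkj hjj end.

(* SINR_1(s1,s2), with h_{i,j} the channel from BS j to user i *)
Definition SINR1 n (P11 P12 : R) (s1 s2 : strategy)
    (h11 h12 h21 h22 : 'cV[R[i]]_n) : R :=
  P11 * abs2 (cdot h11 (precoder s1 h11 h21))
  / (1 + P12 * abs2 (cdot h12 (precoder s2 h22 h12))).

Definition log2 (x : R) : R := ln x / ln 2.

(* ---------- special functions ---------- *)

(* upper incomplete gamma function at s = -k :
   Gamma(-k, x) = \int_x^oo t^(-k-1) e^(-t) dt *)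
Definition incgamma_negnat (k : nat) (x : R) : R :=
  fine (\int[lebesgue_measure]_(t in `[x, +oo[) (t ^- k.+1 * expR (- t))%:E)%E.

Definition R_BF (g : R) (M : nat) : R :=
  (ln 2)^-1 * expR (g^-1) *
  \sum_(k < M) incgamma_negnat k (g^-1) / g ^+ k.

(* I_1(a,b,m,n) = \int_0^oo x^m e^(-a x) / ((x+b)^n (x+1)) dx *)
Definition I1 (a b : R) (m n : nat) : R :=
  fine (\int[lebesgue_measure]_(x in `[0%R : R, +oo[)
          (x ^+ m * expR (- (a * x)) / ((x + b) ^+ n * (x + 1)))%:E)%E.

Definition R_I2 (g1 g2 : R) (M : nat) : R :=
  (ln 2)^-1 *
  \sum_(i < M) \sum_(l < i.+1)
     g1 ^ ((l.+1)%:Z - (i : nat)%:Z) / (g2 * ((i - l)`!)%:R)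
     * I1 (g1^-1) (g1 / g2) i l.+1.

(* ---------- the random channels ---------- *)

(* index (i, j, k, b): entry k of h_{i+1,j+1}; b = false real part,
   b = true imaginary part *)
Definition chan_index n := ('I_2 * 'I_2 * 'I_n * bool)%type.

(* The real random variables X are i.i.d. N(0, 1/2) and mutually
   independent, i.e. the complex entries X(.,false) + i X(.,true) are
   i.i.d. CN(0,1) and the four channels are independent. *)
Definition iid_CN d (T : measurableType d) (P : probability T R) n
    (X : chan_index n -> T -> R) : Prop :=
  [/\ (forall a, measurable_fun setT (X a)),
      (forall a (B : set R), measurable B ->
          P (X a @^-1` B) = normal_prob 0 (Num.sqrt (2^-1)) B) &
      (forall B : chan_index n -> set R, (forall a, measurable (B a)) ->
          P (\bigcap_(a in [set: chan_index n]) X a @^-1` B a)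
          = (\prod_(a : chan_index n) P (X a @^-1` B a))%E)].

Definition chan d (T : measurableType d) n (X : chan_index n -> T -> R)
    (i j : 'I_2) (w : T) : 'cV[R[i]]_n :=
  \col_k (Complex (X (i, j, k, false) w) (X (i, j, k, true) w)).

(* R_1(s1,s2) = E[log2(1 + SINR_1(s1,s2))] (integral of a nonnegative
   function, in \bar R) *)
Definition rate1 d (T : measurableType d) (P : probability T R) n
    (X : chan_index n -> T -> R) (P11 P12 : R) (s1 s2 : strategy) : \bar R :=
  (\int[P]_w (log2 (1 + SINR1 P11 P12 s1 s2
       (chan X 0 0 w) (chan X 0 1 w) (chan X 1 0 w) (chan X 1 1 w)))%:E)%E.

End Defs.

(* Main.v *)
(* The SINR has the form S / (1 + I), and
     ln (1 + S / (1 + I)) = \int_0^oo e^-t e^(-t I) (1 - e^(-t S)) / t dt,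
   so the ergodic rate only depends on the joint Laplace transform of the desired
   power S and of the interference power I. Conditionally on the channels that
   determine the precoding directions, both exponents are quadratic forms in a
   Gaussian vector; integrating the Gaussian coordinates out one at a time gives
   E e^(-a S - b I) = (1 + a)^-M / (1 + b) with M = Nt (BF) or M = Nt - 1 (IC),
   and I = 0 when the interfering base station uses IC. Expanding
   (1 - (1 + g t)^-M) / t as a geometric sum leaves one-dimensional integrals,
   which Fubini and a change of variable turn into incomplete gamma functions and
   into the integrals I_1. *)
Require Import Defs.
From HB Require Import structures.
From mathcomp Require Import all_boot all_order all_algebra.
From mathcomp Require Import all_classical all_reals all_analysis.
From mathcomp Require Import complex.
From mathcomp Require Import measurable_realfun ring lra.

Set Implicit Arguments.
Unset Strict Implicit.
Unset Printing Implicit Defensive.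

Import Order.TTheory GRing.Theory Num.Theory.
Import numFieldNormedType.Exports.
Local Open Scope classical_set_scope.
Local Open Scope ring_scope.

(** * Independence and coordinatewise integration *)

(** The obstacle is that the precoding directions are random: reading off the laws of the powers
    would need a conditional form of the rotation invariance of Gaussian vectors. Instead, the
    exponent of one channel [x] is kept in the form [s |x|^2 + r |<x, d>|^2], with a direction [d]
    that depends only on coordinates of other channels. This family of rank-one perturbations of a
    multiple of the identity is stable under integrating out one coordinate, and what remains at the
    end depends on [d] only through its norm, which is almost surely 1. The directions themselves
    are therefore never integrated. Conditioning is likewise replaced by something more elementary:
    one variable [X a] is independent of the sigma-algebra generated by all the others, so the
    others can be frozen while [X a] is integrated against its law. No joint law on a space of
    families has to be built. The projection of the IC precoder fits the same scheme with a negative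
    [r], which makes positivity of the denominators the condition to watch. *)

(* Measurability for the product sigma-algebra on [I -> R], stated through all the
   families of random variables so as not to have to construct it. *)
Definition coordinatewise_measurable (R : realType) (I : Type)
    (phi : (I -> R) -> R) : Prop :=
  forall d (T : measurableType d) (Y : I -> T -> R),
    (forall i, measurable_fun setT (Y i)) ->
    measurable_fun setT (fun w => phi (Y ^~ w)).

Definition update (R : Type) (I : eqType) (x : I -> R) (a : I) (y : R) : I -> R :=
  fun b => if b == a then y else x b.

(** Quantifying over all measurable spaces pays off here: on [T * R], the family that reads
    coordinate [a] from the second factor is again a family of random variables, and Tonelli gives
    measurability of the partial integral in the first factor. *)
Lemma coordinatewise_measurable_integral (R : realType) (I : eqType)
    (Q : probability (measurableTypeR R) R) (a : I) (phi psi : (I -> R) -> R) :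
  coordinatewise_measurable phi -> (forall x, 0 <= phi x) ->
  (forall x : I -> R, (\int[Q]_y (phi (update x a y))%:E = (psi x)%:E)%E) ->
  coordinatewise_measurable psi.
Proof.
move=> mphi phi0 phipsi d T Y mY; apply/measurable_EFinP.
pose g (z : T * measurableTypeR R) := (phi (update (Y ^~ z.1) a z.2))%:E.
rewrite (_ : EFin \o _ = fubini_F Q g); last first.
  by apply/funext => w /=; rewrite -phipsi.
apply: measurable_fun_fubini_tonelli_F => [|z]; last by rewrite lee_fin.
apply/measurable_EFinP.
apply: (mphi _ (T * measurableTypeR R)%type
  (fun b z => if b == a then z.2 else Y b z.1)) => b.
case: eqVneq => [_|_]; first exact: measurable_snd.
exact: measurableT_comp.
Qed.

Section independence.
Context (R : realType) d (T : measurableType d) (P : probability T R).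
Context (I : finType) (X : I -> T -> R) (Q : probability (measurableTypeR R) R).
Hypothesis mX : forall a, measurable_fun setT (X a).
Hypothesis lawX : forall a (B : set R), measurable B -> P (X a @^-1` B) = Q B.
Hypothesis indepX : forall B : I -> set R, (forall a, measurable (B a)) ->
  P (\bigcap_(a in [set: I]) X a @^-1` B a) = (\prod_(a : I) P (X a @^-1` B a))%E.

(** A pi-system generating the sigma-algebra of the variables other than [X a]. *)
Let cylinders (a : I) : set (set T) :=
  [set A | exists2 B : I -> set R, (forall b, measurable (B b)) &
     A = \bigcap_(b in [set b | b != a]) X b @^-1` B b].

Let cylinders_setI a : setI_closed (cylinders a).
Proof.
move=> _ _ [B mB ->] [C mC ->]; exists (fun b => B b `&` C b).
  by move=> b; exact: measurableI.
by rewrite -bigcapI; apply: eq_bigcapr => b _; rewrite preimage_setI.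
Qed.

Let measurable_preimage b (B : set R) : measurable B -> measurable (X b @^-1` B).
Proof. by move=> mB; rewrite -[X in measurable X]setTI; exact: mX. Qed.

Let cylinders_measurable a A : cylinders a A -> measurable A.
Proof.
move=> [B mB ->]; apply: fin_bigcap_measurable => [|b _].
  exact: finite_finset.
exact: measurable_preimage.
Qed.

Let bigcap_split a (B : I -> set R) (C : set R) :
  (\bigcap_(b in [set b | b != a]) X b @^-1` B b) `&` X a @^-1` C =
  \bigcap_(b in [set: I]) X b @^-1` (if b == a then C else B b).
Proof.
apply/seteqP; split => w.
  by move=> [h1 h2] b _ /=; case: eqVneq => [->//|ba]; exact: h1.
move=> h; split; last by have := h a Logic.I; rewrite /= eqxx.
by move=> b /= ba; have := h b Logic.I; rewrite /= (negbTE ba).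
Qed.

Let indep_cylinder a A (C : set R) : cylinders a A -> measurable C ->
  P (A `&` X a @^-1` C) = (P (X a @^-1` C) * P A)%E.
Proof.
move=> [B mB ->] mC; rewrite bigcap_split indepX; last first.
  by move=> b; case: ifP.
have -> : \bigcap_(b in [set b | b != a]) X b @^-1` B b =
    \bigcap_(b in [set: I]) X b @^-1` (if b == a then setT else B b).
  by rewrite -bigcap_split preimage_setT setIT.
rewrite indepX; last by move=> b; case: ifP.
rewrite (bigD1 a)//= [in RHS](bigD1 a)//= eqxx preimage_setT probability_setT.
rewrite mul1e; congr (_ * _)%E.
by apply: eq_bigr => b /negbTE ->.
Qed.

(** For fixed [C], both sides are finite measures in [A]: the restriction of [P] to the event [X a]
    in [C], and a multiple of [P]. They agree on the pi-system [cylinders a], hence on the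
    sigma-algebra it generates. *)
Let indep_sigma a A (C : set R) : <<s cylinders a >> A -> measurable C ->
  P (A `&` X a @^-1` C) = (P A * P (X a @^-1` C))%E.
Proof.
move=> sA mC; have mXC := measurable_preimage a mC.
have Xfin := fin_num_measure P _ mXC.
have p0 : 0 <= fine (P (X a @^-1` C)) by exact: fine_ge0.
pose m2 := mscale (NngNum p0) P.
have -> : P (A `&` X a @^-1` C) = mrestr P mXC A by [].
rewrite (@g_sigma_algebra_measure_unique _ _ _ (cylinders a) _ (fun=> setT) _ _
  (mrestr P mXC) m2 (@cylinders_setI a) _ _ _ sA)//=.
- by rewrite /m2 /mscale/= fineK// muleC.
- exact: cylinders_measurable.
- move=> _; exists (fun=> setT) => //.
  by apply/esym; rewrite -subTset => w _ b _.
- by rewrite -subTset => w _; exists 0%N.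
- move=> B cB; rewrite /mrestr /m2 /mscale/= indep_cylinder// fineK//.
- by move=> _; rewrite /mrestr setTI ltey_eq Xfin.
Qed.

Local Notation TG a := (g_sigma_algebraType (cylinders a)).

(** [TG a] is [T] with the coarser sigma-algebra of the other variables. By independence the map
    [w |-> (w, X a w)] into [TG a * R] has a product law, so Tonelli integrates [X a] with
    everything else frozen. *)
Lemma integrate_coordinate (a : I) (phi psi : (I -> R) -> R) :
  coordinatewise_measurable phi -> (forall x, 0 <= phi x) ->
  (forall x : I -> R, (\int[Q]_y (phi (update x a y))%:E = (psi x)%:E)%E) ->
  (\int[P]_w (phi (X ^~ w))%:E = \int[P]_w (psi (X ^~ w))%:E)%E.
Proof.
move=> mphi phi0 phipsi.
have mid : measurable_fun setT (idfun : T -> TG a).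
  move=> _ A sA; rewrite setTI preimage_id.
  have := sA; apply: smallest_sub.
    exact: sigma_algebra_measurable.
  exact: cylinders_measurable.
pose V (w : T) : TG a * measurableTypeR R := (w, X a w).
have mV : measurable_fun setT V by apply/measurable_fun_pairP; split => //; exact: mX.
pose idm : {mfun T >-> (TG a)} := HB.pack (idfun : T -> TG a)
  (isMeasurableFun.Build _ _ T (TG a) _ mid).
pose Vm : {mfun T >-> (TG a * measurableTypeR R)%type} := HB.pack V
  (isMeasurableFun.Build _ _ _ _ _ mV).
pose g (z : TG a * measurableTypeR R) := phi (update (X ^~ z.1) a z.2).
have mg : measurable_fun [set: TG a * measurableTypeR R] (fun z => (g z)%:E).
  apply/measurable_EFinP.
  apply: (mphi _ (TG a * measurableTypeR R)%type
    (fun b z => if b == a then z.2 else X b z.1)) => b.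
  case: eqVneq => [_|ba]; first exact: measurable_snd.
  suff mXb : measurable_fun setT (X b : TG a -> R).
    exact: (measurableT_comp mXb measurable_fst).
  move=> _ B mB; rewrite setTI.
  apply: sub_sigma_algebra; exists (fun c => if c == b then B else setT).
    by move=> c; case: ifP.
  apply/seteqP; split => w /=.
    by move=> XbB c _; case: eqVneq => [->|].
  by move=> /(_ b ba); rewrite /= eqxx.
have product_law A : measurable A ->
    (distribution P idm \x Q)%E A = distribution P Vm A.
  apply: product_measure_unique => B C mB mC.
  rewrite /distribution /pushforward /= -(lawX a)//.
  exact: indep_sigma.
transitivity (\int[distribution P Vm]_z (g z)%:E)%E.
  rewrite ge0_integral_distribution//=; last first.
    by move=> z; rewrite lee_fin phi0.
  apply: eq_integral => w _ /=; congr (phi _)%:E; apply/funext => b.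
  by rewrite /update; case: eqVneq => [->|].
rewrite -(eq_measure_integral _ (fun A mA _ => product_law A mA)).
rewrite (fubini_tonelli1 (EFin \o g))//=; last by move=> z; rewrite lee_fin phi0.
have F_psi w : (\int[Q]_y (EFin \o g) (w, y) = (psi (X ^~ w))%:E)%E.
  by rewrite -phipsi.
rewrite /fubini_F; under eq_integral do rewrite F_psi.
rewrite ge0_integral_distribution//=.
(* Measurability is needed for the coarser space [TG a]; it comes from the integrand being a partial
   integral over [TG a * R]. *)
- rewrite (_ : (fun w => _) = fubini_F Q (EFin \o g)).
    by apply: measurable_fun_fubini_tonelli_F => // z; rewrite lee_fin phi0.
  by apply/funext => w; rewrite -F_psi.
- move=> w; rewrite -F_psi; apply: integral_ge0 => y _.
  by rewrite lee_fin phi0.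
Qed.
End independence.

(** * Laplace transforms of Gaussian quadratic forms *)

(** The Radon-Nikodym derivative and [normal_pdf] have the same integral over every measurable set,
    hence coincide almost everywhere. *)
Lemma ge0_integral_normal_prob (R : realType) (m s : R)
    (f : measurableTypeR R -> \bar R) :
  measurable_fun setT f -> (forall x, 0 <= f x)%E ->
  (\int[normal_prob m s]_x f x =
   \int[lebesgue_measure]_x (f x * (normal_pdf m s x)%:E))%E.
Proof.
move=> mf f0; have dom := normal_prob_dominates m s.
rewrite -(Radon_Nikodym_SigmaFinite.change_of_variables dom)//.
apply: ae_eq_integral => //.
- apply: emeasurable_funM => //; apply: (measurable_int lebesgue_measure).
  exact: Radon_Nikodym_SigmaFinite.f_integrable.
- apply: emeasurable_funM => //; apply/measurable_EFinP.
  exact: measurable_normal_pdf.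
- apply: ae_eqe_mul2l; apply: integral_ae_eq => //.
  + exact: Radon_Nikodym_SigmaFinite.f_integrable.
  + by apply/measurable_EFinP; exact: measurable_normal_pdf.
  + by move=> E _ mE; rewrite -Radon_Nikodym_SigmaFinite.f_integral.
Qed.

(** Completing the square: variance 1/2 means a density proportional to [expR (- y ^+ 2)], so the
    integrand is a constant times the normal density of mean [- p / (1 + c)] and variance
    [1 / (2 (1 + c))]. *)
Lemma integral_normal_expR_quadratic (R : realType) (c p : R) : -1 < c ->
  (\int[normal_prob (0:R) (Num.sqrt 2^-1)]_y (expR (- (c * y ^+ 2 + 2 * p * y)))%:E
   = ((Num.sqrt (1 + c))^-1 * expR (p ^+ 2 / (1 + c)))%:E)%E.
Proof.
move=> c1; have c10 : 0 < 1 + c by lra.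
have s20 : 0 < Num.sqrt (2^-1 : R) by rewrite sqrtr_gt0 invr_gt0.
have k20 : 0 < (2 * (1 + c))^-1 by rewrite invr_gt0 mulr_gt0.
have k0 : 0 < Num.sqrt ((2 * (1 + c))^-1) by rewrite sqrtr_gt0.
rewrite ge0_integral_normal_prob; last 2 first.
  apply/measurable_EFinP; apply: measurableT_comp => //.
  apply: measurableT_comp => //; apply: measurable_funD.
    by apply: measurable_funM => //; exact: measurable_funX.
  exact: measurable_funM.
  by move=> y; rewrite lee_fin expR_ge0.
under eq_integral => y _.
  have -> : ((expR (- (c * y ^+ 2 + 2 * p * y)))%:E *
      (normal_pdf 0 (Num.sqrt 2^-1) y)%:E)%E
   = (((Num.sqrt (1 + c))^-1 * expR (p ^+ 2 / (1 + c)))%:E *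
     (normal_pdf (- p / (1 + c)) (Num.sqrt ((2 * (1 + c))^-1)) y)%:E)%E.
    rewrite -!EFinM !normal_pdfE ?gt_eqF// /normal_peak /normal_fun.
    rewrite !sqr_sqrtr ?invr_ge0 ?(ltW c10)//; last by rewrite mulr_ge0// ltW.
    rewrite (_ : 2^-1 * pi *+ 2 = pi :> R); last by rewrite -mulr_natr; field.
    rewrite (_ : (2 * (1 + c))^-1 * pi *+ 2 = (1 + c)^-1 * pi :> R); last first.
      by rewrite -mulr_natr; field; rewrite gt_eqF.
    rewrite sqrtrM ?invr_ge0 ?(ltW c10)// sqrtrV ?(ltW c10)// invfM invrK.
    rewrite mulrCA -expRD [in RHS]mulrA mulrACA mulVf ?gt_eqF ?sqrtr_gt0//.
    rewrite mul1r [in RHS]mulrAC -expRD mulrC; congr (expR _ * _)%:E.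
    by rewrite -mulr_natr -[in RHS]mulr_natr; field; rewrite gt_eqF.
  over.
rewrite ge0_integralZl//=; last 2 first.
- by apply/measurable_EFinP; exact: measurable_normal_pdf.
- by move=> y _; rewrite lee_fin normal_pdf_ge0.
by rewrite integral_normal_pdf mule1.
Qed.

Definition invariant_at (R : realType) (I : eqType) (a : I) (F : (I -> R) -> R) :=
  forall x v, F (update x a v) = F x.

Definition invariant_on (R : realType) (I : eqType) (J : Type) (re im : J -> I)
    (F : (I -> R) -> R) :=
  (forall k, invariant_at (re k) F) /\ (forall k, invariant_at (im k) F).

Section gaussian_family.
Context (R : realType) d (T : measurableType d) (P : probability T R).
Context (I : finType) (X : I -> T -> R).
Hypothesis mX : forall a, measurable_fun setT (X a).
Hypothesis lawX : forall a (B : set R), measurable B ->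
  P (X a @^-1` B) = normal_prob 0 (Num.sqrt (2^-1)) B.
Hypothesis indepX : forall B : I -> set R, (forall a, measurable (B a)) ->
  P (\bigcap_(a in [set: I]) X a @^-1` B a) = (\prod_(a : I) P (X a @^-1` B a))%E.

(** Measurability and nonnegativity of [psi] travel with the equality because integrating the next
    coordinate requires them. *)
Let reduces (phi psi : (I -> R) -> R) :=
  [/\ coordinatewise_measurable psi, (forall x, 0 <= psi x) &
  (\int[P]_w (phi (X ^~ w))%:E = \int[P]_w (psi (X ^~ w))%:E)%E].

Let reduces_coordinate a (phi K c p : (I -> R) -> R) :
  coordinatewise_measurable phi -> (forall x, 0 <= phi x) ->
  (forall x, -1 < c x) ->
  (forall x y, phi (update x a y) = K x * expR (- (c x * y ^+ 2 + 2 * p x * y))) ->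
  reduces phi (fun x =>
    K x * ((Num.sqrt (1 + c x))^-1 * expR (p x ^+ 2 / (1 + c x)))).
Proof.
move=> mphi phi0 c1 phiE.
have K0 x : (0 <= (K x)%:E)%E.
  rewrite lee_fin; have := phi0 (update x a 0).
  by rewrite phiE expr0n/= !mulr0 addr0 oppr0 expR0 mulr1.
have int x : (\int[normal_prob (0:R) (Num.sqrt 2^-1)]_y (phi (update x a y))%:E =
    (K x * ((Num.sqrt (1 + c x))^-1 * expR (p x ^+ 2 / (1 + c x))))%:E)%E.
  under eq_integral do rewrite phiE EFinM.
  rewrite ge0_integralZl//=; last 1 first.
    apply/measurable_EFinP; do 2 apply: measurableT_comp => //.
    apply: measurable_funD; last exact: measurable_funM.
    by apply: measurable_funM => //; exact: measurable_funX.
  by rewrite integral_normal_expR_quadratic// -EFinM.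
split.
- exact: coordinatewise_measurable_integral int.
- move=> x; rewrite mulr_ge0 -?lee_fin// lee_fin.
  by rewrite mulr_ge0 ?expR_ge0// invr_ge0 sqrtr_ge0.
- exact: integrate_coordinate int.
Qed.

(* One complex coordinate [u + i v]: [A + i B] is the contribution of the other
   coordinates to the inner product, and the cross terms in [u * v] cancel. *)
Let reduces_pair re im (phi K rho A B al be : (I -> R) -> R) s :
  re != im -> invariant_at im K -> invariant_at im rho -> invariant_at im A ->
  invariant_at im B -> invariant_at im al -> invariant_at im be ->
  coordinatewise_measurable phi -> (forall x, 0 <= phi x) ->
  (forall x, 0 < 1 + s + rho x * (al x ^+ 2 + be x ^+ 2)) ->
  (forall x u v, phi (update (update x re u) im v) =
     K x * expR (- (s * (u ^+ 2 + v ^+ 2) + rho x *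
       ((A x + (u * al x + v * be x)) ^+ 2 + (B x + (u * be x - v * al x)) ^+ 2)))) ->
  reduces phi (fun x => let g := 1 + s + rho x * (al x ^+ 2 + be x ^+ 2) in
    K x * (g^-1 * expR (- (rho x * (1 + s) / g * (A x ^+ 2 + B x ^+ 2))))).
Proof.
move=> reim iK irho iA iB ial ibe mphi phi0 g0 phiE.
set psi := (X in reduces _ X).
pose c x := s + rho x * (al x ^+ 2 + be x ^+ 2).
pose p x := rho x * (A x * al x + B x * be x).
pose p' x := rho x * (A x * be x - B x * al x).
pose K1 x := K x * expR (- (s * x im ^+ 2 + rho x *
  ((A x + x im * be x) ^+ 2 + (B x - x im * al x) ^+ 2))).
pose K2 x := K x * (Num.sqrt (1 + c x))^-1 *
  expR (p x ^+ 2 / (1 + c x) - rho x * (A x ^+ 2 + B x ^+ 2)).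
have c1 x : -1 < c x by have := g0 x; rewrite /c; lra.
have [] := @reduces_coordinate re phi K1 c p mphi phi0 c1.
  move=> x u.
  have -> : update x re u = update (update x re u) im (x im).
    apply/funext => b; rewrite /update; case: (eqVneq b im) => [->|//].
    by rewrite eq_sym (negbTE reim).
  rewrite phiE /K1 -mulrA -expRD; congr (_ * expR _).
  by rewrite /c /p; ring.
set phi1 := fun x => _ => mphi1 phi10; rewrite /reduces => ->.
have [] := @reduces_coordinate im phi1 K2 c p' mphi1 phi10 c1.
  move=> x v; rewrite /phi1 /K2 /K1 /c /p /p' !(iK, irho, iA, iB, ial, ibe).
  rewrite (_ : update x im v im = v); last by rewrite /update eqxx.
  rewrite -!mulrA; congr (_ * _); rewrite mulrCA; congr (_ * _).
  by rewrite -!expRD; congr (expR _); ring.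
move=> mpsi psi0 intE.
suff -> : psi = (fun x => K2 x * ((Num.sqrt (1 + c x))^-1 *
   expR (p' x ^+ 2 / (1 + c x)))) by [].
apply/funext => x; rewrite /psi /K2 /c addrA /=.
set g := 1 + s + _; have g0x : 0 < g by exact: g0.
have -> (t u v w : R) : t * u * v * (u * w) = t * ((u * u) * (v * w)) by ring.
rewrite -invfM -expr2 sqr_sqrtr ?ltW// -expRD; congr (_ * (_ * expR _)).
(* The two squares combine by [p^2 + p'^2 = rho^2 (A^2 + B^2) (al^2 + be^2)], and
   [g - rho (al^2 + be^2) = 1 + s] yields the new coefficient. *)
rewrite /p /p' /g; field.
by rewrite gt_eqF.
Qed.

Section channel.
Context (n : nat) (re im : 'I_n -> I).
Hypotheses (re_inj : injective re) (im_inj : injective im).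
Hypothesis reim : forall j k, re j != im k.

Let block_sum (m : nat) (F : 'I_n -> (I -> R) -> R) x :=
  \sum_(j < n | (j < m)%N) F j x.

Let block_sumS (k : 'I_n) F x : block_sum k.+1 F x = block_sum k F x + F k x.
Proof.
rewrite /block_sum (bigD1 k)//= addrC; congr (_ + _); apply: eq_bigl => j.
by rewrite ltnS [RHS]ltn_neqAle andbC.
Qed.

Let block_sum_invariant a m F : (forall j : 'I_n, (j < m)%N -> invariant_at a (F j)) ->
  invariant_at a (block_sum m F).
Proof. by move=> iF x v; apply: eq_bigr => j jm; exact: iF. Qed.

Context (al be : 'I_n -> (I -> R) -> R) (W : (I -> R) -> R) (s r : R).
Hypotheses (al_free : forall j, invariant_on re im (al j))
  (be_free : forall j, invariant_on re im (be j)) (W_free : invariant_on re im W).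
Hypothesis s1 : 0 < 1 + s.

Let N j (x : I -> R) := x (re j) ^+ 2 + x (im j) ^+ 2.
(** [A j] and [B j] are the real and imaginary parts of the conjugate of the [j]-th complex
    coordinate times [al j + i be j]. *)
Let A j (x : I -> R) := x (re j) * al j x + x (im j) * be j x.
Let B j (x : I -> R) := x (re j) * be j x - x (im j) * al j x.
Let q j x := al j x ^+ 2 + be j x ^+ 2.
(** By the matrix determinant lemma, [(1 + s)^(n - m) * D m / (1 + s)] is the determinant of
    [(1 + s) Id + r d d^H] on the coordinates from [m] on, with [d = al + i be]. The Schur
    complement of that block turns [r] into [r (1 + s) / D m] on the remaining coordinates. *)
Let D m x := 1 + s + r * \sum_(j < n | (m <= j)%N) q j x.

Hypothesis denominator_gt0 : forall m x,
  0 < 1 + s + r * \sum_(j < n | (m <= j)%N) (al j x ^+ 2 + be j x ^+ 2).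

Let D_gt0 m x : 0 < D m x. Proof. exact: denominator_gt0. Qed.

(* What is left once the coordinates [m, ..., n - 1] have been integrated out. *)
Let phi m x := W x * (1 + s) ^- (n - m) * ((1 + s) / D m x) *
  expR (- (s * block_sum m N x + r * (1 + s) / D m x *
    (block_sum m A x ^+ 2 + block_sum m B x ^+ 2))).

Let DS (k : 'I_n) x : D k x = D k.+1 x + r * q k x.
Proof.
rewrite /D -[RHS]addrA -mulrDr; congr (_ + _ * _).
rewrite (bigD1 k)//= [RHS]addrC; congr (_ + _).
by apply: eq_bigl => j; rewrite [RHS]ltn_neqAle andbC eq_sym.
Qed.

Let free_re (F : (I -> R) -> R) k :
  invariant_on re im F -> invariant_at (re k) F.
Proof. by case. Qed.

Let free_im (F : (I -> R) -> R) k :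
  invariant_on re im F -> invariant_at (im k) F.
Proof. by case. Qed.

Let D_free m : invariant_on re im (D m).
Proof.
split=> k x v; rewrite /D; congr (_ + _ * _); apply: eq_bigr => j _; rewrite /q.
  by rewrite (free_re k (al_free j)) (free_re k (be_free j)).
by rewrite (free_im k (al_free j)) (free_im k (be_free j)).
Qed.

Let other_re (F : 'I_n -> (I -> R) -> R) (k : 'I_n) :
  (forall j x y, x (re j) = y (re j) -> x (im j) = y (im j) ->
    al j x = al j y -> be j x = be j y -> F j x = F j y) ->
  invariant_at (re k) (block_sum k F) /\ invariant_at (im k) (block_sum k F).
Proof.
move=> hF; split; apply: block_sum_invariant => j jk x v; apply: hF; rewrite /update.
- by rewrite (inj_eq re_inj) -val_eqE/= ltn_eqF.
- by rewrite eq_sym (negbTE (reim _ _)).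
- exact: (free_re k (al_free j)).
- exact: (free_re k (be_free j)).
- by rewrite (negbTE (reim _ _)).
- by rewrite (inj_eq im_inj) -val_eqE/= ltn_eqF.
- exact: (free_im k (al_free j)).
- exact: (free_im k (be_free j)).
Qed.

Let reduces_step (k : 'I_n) : coordinatewise_measurable (phi k.+1) ->
  (forall x, 0 <= phi k.+1 x) -> reduces (phi k.+1) (phi k).
Proof.
move=> mphi phi0.
have [Nr Ni] : invariant_at (re k) (block_sum k N) /\ invariant_at (im k) (block_sum k N).
  by apply: (@other_re N k) => j x y; rewrite /N => -> ->.
have [Ar Ai] : invariant_at (re k) (block_sum k A) /\ invariant_at (im k) (block_sum k A).
  by apply: (@other_re A k) => j x y; rewrite /A => -> -> -> ->.
have [Br Bi] : invariant_at (re k) (block_sum k B) /\ invariant_at (im k) (block_sum k B).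
  by apply: (@other_re B k) => j x y; rewrite /B => -> -> -> ->.
have [alr ali] := al_free k; have [ber bei] := be_free k.
have [Wr Wi] := W_free; have [Dr Di] := D_free k.+1.
have s10 : 1 + s != 0 by rewrite gt_eqF.
have Dn0 m x : D m x != 0 by rewrite gt_eqF.
pose rho x := r * (1 + s) / D k.+1 x.
(* Dividing by this quantity replaces [D k.+1] by [D k] and adds one power of [1 / (1 + s)]: the
   denominators telescope. *)
have gE x : 1 + s + rho x * (al k x ^+ 2 + be k x ^+ 2) = (1 + s) * (D k x / D k.+1 x).
  by rewrite /rho DS /q; field.
pose K x := W x * (1 + s) ^- (n - k.+1) * ((1 + s) / D k.+1 x) *
  expR (- (s * block_sum k N x)).
rewrite (_ : phi k = fun x => let g := 1 + s + rho x * (al k x ^+ 2 + be k x ^+ 2) in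
    K x * (g^-1 * expR (- (rho x * (1 + s) / g *
      (block_sum k A x ^+ 2 + block_sum k B x ^+ 2))))).
  apply: (@reduces_pair (re k) (im k)) => //.
  - by move=> x v; rewrite /K Wi Di Ni.
  - by move=> x v; rewrite /rho Di.
  - by move=> x; rewrite gE mulr_gt0// divr_gt0.
  - move=> x u v; rewrite /phi /K !block_sumS /N /A /B.
    rewrite !(Wi, Wr, Di, Dr, Ni, Nr, Ai, Ar, Bi, Br, ali, alr, bei, ber).
    have -> : update (update x (re k) u) (im k) v (re k) = u.
      by rewrite /update (negbTE (reim _ _)) eqxx.
    have -> : update (update x (re k) u) (im k) v (im k) = v by rewrite /update eqxx.
    by rewrite -[in RHS]mulrA -expRD /rho; congr (_ * expR _); ring.
apply/funext => x; rewrite /= gE /phi /K -(subnSK (ltn_ord k)) exprS.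
have -> : r * (1 + s) / D k x = rho x * (1 + s) / ((1 + s) * (D k x / D k.+1 x)).
  by rewrite /rho; field; rewrite s10 !Dn0.
rewrite opprD expRD mulrA [RHS]mulrA; congr (_ * _).
rewrite [RHS]mulrAC; congr (_ * _).
have := expf_neq0 (n - k.+1) s10; set t := (1 + s) ^+ _ => t0.
by field; rewrite s10 !Dn0.
Qed.

Let reduces_all :
  coordinatewise_measurable (phi n) -> (forall x, 0 <= W x) ->
  reduces (phi n) (phi 0%N).
Proof.
move=> mphi W0.
have phi0 m x : 0 <= phi m x.
  by rewrite /phi !mulr_ge0 ?expR_ge0 ?W0 ?invr_ge0 ?exprn_ge0 ?(ltW s1) ?ltW.
suff H m : (m <= n)%N -> reduces (phi n) (phi (n - m)).
  by have := H n (leqnn _); rewrite subnn.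
elim: m => [_|m IH mn]; first by rewrite subn0.
have [mm m0 mE] := IH (ltnW mn).
have kn : (n - m.+1 < n)%N by rewrite ltn_subrL /= (leq_trans _ mn).
have Ek : (n - m.+1).+1 = (n - m)%N by rewrite subnSK.
have step := @reduces_step (Ordinal kn); rewrite /= Ek in step.
have [mk k0 kE] := step mm m0.
by split; [exact: mk|exact: k0|rewrite mE].
Qed.

(* [r < 0] is allowed: [r = - s] with a unit direction [(al, be)] gives the squared
   norm of the projection orthogonal to that direction. *)
Lemma gaussian_quadratic_laplace (phi0 := fun x => W x * expR (- (
      s * \sum_(j < n) (x (re j) ^+ 2 + x (im j) ^+ 2) +
      r * ((\sum_(j < n) (x (re j) * al j x + x (im j) * be j x)) ^+ 2 +
           (\sum_(j < n) (x (re j) * be j x - x (im j) * al j x)) ^+ 2))))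
    (psi := fun x => W x * (1 + s) ^- n *
      ((1 + s) / (1 + s + r * \sum_(j < n) (al j x ^+ 2 + be j x ^+ 2)))) :
  coordinatewise_measurable phi0 -> (forall x, 0 <= W x) ->
  coordinatewise_measurable psi /\
  (\int[P]_w (phi0 (X ^~ w))%:E = \int[P]_w (psi (X ^~ w))%:E)%E.
Proof.
have s10 : 1 + s != 0 by rewrite gt_eqF.
have block_sumT F x : block_sum n F x = \sum_(j < n) F j x.
  by apply: eq_bigl => j; rewrite ltn_ord.
have -> : phi0 = phi n.
  apply/funext => x; rewrite /phi0 /phi /D.
  rewrite [\sum_(j < n | (n <= j)%N) _]big_pred0; last first.
    by move=> j; rewrite leqNgt ltn_ord.
  rewrite subnn expr0 invr1 mulr0 addr0 divff// !mulr1 mulfK//.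
  by rewrite !block_sumT.
have -> : psi = phi 0%N.
  apply/funext => x; rewrite /psi /phi /D subn0 /block_sum.
  rewrite ![\sum_(j < n | (j < 0)%N) _]big_pred0// expr0n/=.
  by rewrite addr0 !mulr0 addr0 oppr0 expR0 mulr1.
by move=> mphi W0; have [] := reduces_all mphi W0.
Qed.
End channel.
End gaussian_family.

(** * Integrals over the half-line *)

Section measurable_arithmetic.
Context (R : realType) d (T : measurableType d) (D : set T).
Implicit Types f : T -> R.

(** Inversion is reduced to a real power of the square, which is measurable on the whole line; at a
    zero of [f] both expressions are [0]. *)
Lemma measurable_fun_inv f : measurable_fun D f ->
  measurable_fun D (fun x => (f x)^-1).
Proof.
move=> mf.
rewrite (_ : (fun x => _) = fun x => f x * ((f x ^+ 2) `^ (-1))); last first.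
  apply/funext => x; rewrite powR_inv1 ?sqr_ge0//.
  have [->|f0] := eqVneq (f x) 0; first by rewrite invr0 mul0r.
  by field.
apply: measurable_funM => //.
apply: (measurableT_comp (measurable_powR _)); exact: measurable_funX.
Qed.

Lemma measurable_fun_sqrt f : measurable_fun D f ->
  measurable_fun D (fun x => Num.sqrt (f x)).
Proof.
apply: measurableT_comp; apply: nondecreasing_measurable => //.
exact: ler_wsqrtr.
Qed.

Lemma measurable_fun_expR f : measurable_fun D f ->
  measurable_fun D (fun x => expR (f x)).
Proof. exact: measurableT_comp. Qed.

Lemma measurable_fun_ln f : measurable_fun D f ->
  measurable_fun D (fun x => ln (f x)).
Proof. by apply: measurableT_comp; exact: measurable_ln. Qed.
End measurable_arithmetic.

Ltac solve_measurable := repeat first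
  [ exact: measurable_cst | exact: measurable_id | exact: measurable_fst
  | exact: measurable_snd | assumption
  | apply: measurable_fun_expR | apply: measurable_fun_inv
  | apply: measurable_fun_sqrt | apply: measurable_fun_ln
  | apply: measurable_funX | apply: measurable_funN
  | apply: measurable_funB | apply: measurable_funD | apply: measurable_funM ].

Section tonelli.
Context d1 d2 (T1 : measurableType d1) (T2 : measurableType d2) (R : realType).
Variables (m1 : {sigma_finite_measure set T1 -> \bar R})
          (m2 : {sigma_finite_measure set T2 -> \bar R}).
Local Open Scope ereal_scope.

(** Extended by [0] off the rectangle, the integrand is nonnegative everywhere, so Tonelli on the
    full product applies although [f] may change sign outside. *)
Lemma fubini_tonelli_setX (D1 : set T1) (D2 : set T2) (f : T1 -> T2 -> R) :
  measurable D1 -> measurable D2 ->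
  measurable_fun setT (fun z : T1 * T2 => f z.1 z.2) ->
  (forall x y, D1 x -> D2 y -> (0 <= f x y)%R) ->
  \int[m1]_(x in D1) \int[m2]_(y in D2) (f x y)%:E =
  \int[m2]_(y in D2) \int[m1]_(x in D1) (f x y)%:E.
Proof.
move=> mD1 mD2 mf f0.
pose g := (fun z : T1 * T2 => (f z.1 z.2)%:E) \_ (D1 `*` D2).
have g0 z : 0 <= g z.
  rewrite /g patchE; case: ifPn => //; rewrite inE => -[D1z D2z].
  by rewrite lee_fin f0.
have mg : measurable_fun setT g.
  apply/measurable_restrict => //; first exact: measurableX.
  by apply: measurable_funTS; apply/measurable_EFinP.
have := @fubini_tonelli _ _ _ _ _ m1 m2 _ mg g0.
move=> gE; rewrite integral_mkcond [RHS]integral_mkcond; move: gE.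
have -> : (fun x => \int[m2]_y g (x, y)) =
    (fun x => \int[m2]_(y in D2) (f x y)%:E) \_ D1.
  apply/funext => x; rewrite patchE; case: ifPn => xD1.
    rewrite [RHS]integral_mkcond; apply: eq_integral => y _.
    rewrite /g !patchE; congr (if _ then _ else _).
    by rewrite in_setX/= xD1.
  rewrite integral0_eq// => y _; rewrite /g patchE ifF//; apply/negbTE.
  by apply: contra xD1; rewrite !inE => -[].
have -> : (fun y => \int[m1]_x g (x, y)) =
    (fun y => \int[m1]_(x in D1) (f x y)%:E) \_ D2.
  apply/funext => y; rewrite patchE; case: ifPn => yD2.
    rewrite [RHS]integral_mkcond; apply: eq_integral => x _.
    rewrite /g !patchE; congr (if _ then _ else _).
    by rewrite in_setX/= yD2 andbT.
  rewrite integral0_eq// => x _; rewrite /g patchE ifF//; apply/negbTE.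
  by apply: contra yD2; rewrite !inE => -[].
by [].
Qed.
End tonelli.

Lemma is_derive_exprn (R : realType) (k : nat) (x : R) :
  is_derive x (1 : R) (fun y : R => y ^+ k) (k%:R * x ^+ k.-1).
Proof.
rewrite (_ : (fun y : R => y ^+ k) = (@id R) ^+ k); last first.
  by apply/funext => y; rewrite exprfctE.
apply: (is_derive_eq (is_deriveX k (is_derive_id x (1 : R)))).
by rewrite /GRing.scale/= mulr1.
Qed.

Lemma is_derive_expR_scale (R : realType) (c x : R) :
  is_derive x (1 : R) (fun y : R => expR (- (c * y))) (- c * expR (- (c * x))).
Proof.
have dcx : is_derive x (1 : R) (fun y : R => - (c * y)) (- c).
  apply: (is_derive_eq (is_deriveN (is_deriveZ c (is_derive_id x (1 : R))))).
  by rewrite /GRing.scale/= mulr1.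
by apply: (is_derive_eq (is_derive1_comp (is_derive_expR _) dcx)); rewrite mulrC.
Qed.

Lemma is_derive_exprn_expR (R : realType) (k : nat) (c x : R) :
  is_derive x (1 : R) (fun y : R => y ^+ k * expR (- (c * y)))
    (k%:R * x ^+ k.-1 * expR (- (c * x)) - c * (x ^+ k * expR (- (c * x)))).
Proof.
apply: (is_derive_eq (is_deriveM (is_derive_exprn k x) (is_derive_expR_scale c x))).
by rewrite /GRing.scale/=; ring.
Qed.

Section gamma_integral.
Context {R : realType}.
Local Notation mu := (@lebesgue_measure R).

(** Half of the exponential rate bounds the power, the other half gives the decay. The bound is the
    [k]-th power of [x e^(-a x) <= 1/a] with [a = c / (2 k)], itself a consequence of
    [1 + y <= e^y]. *)
Lemma exprn_expR_cvg0 (k : nat) (c : R) : 0 < c ->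
  (fun x : R => x ^+ k * expR (- (c * x))) x @[x --> +oo] --> 0.
Proof.
move=> c0.
have c20 : 0 < c / 2 by rewrite divr_gt0.
have [C C0 bnd] : exists2 C : R, 0 <= C & forall x, 0 <= x ->
    x ^+ k * expR (- (c / 2 * x)) <= C.
  case: k => [|k].
    exists 1 => // x x0; rewrite mul1r -[leRHS]expR0 ler_expR oppr_le0.
    by rewrite mulr_ge0 ?(ltW c20).
  pose a := c / 2 / k.+1%:R; have a0 : 0 < a by rewrite divr_gt0.
  exists (a^-1 ^+ k.+1) => [|x x0]; first by rewrite exprn_ge0// invr_ge0 ltW.
  have -> : expR (- (c / 2 * x)) = expR (- (a * x)) ^+ k.+1.
    rewrite -expRM_natl; congr expR; rewrite /a.
    have : k.+1%:R != 0 :> R by rewrite pnatr_eq0.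
    by move: (k.+1%:R : R) => K K0; field.
  rewrite -exprMn lerXn2r ?nnegrE ?mulr_ge0 ?expR_ge0 ?invr_ge0 ?(ltW a0)//.
  rewrite expRN ler_pdivrMr ?expR_gt0// ler_pdivlMl//.
  by apply: le_trans (expR_ge1Dx _); rewrite lerDr.
apply: (@squeeze_cvgr _ _ _ _ (cst 0) (fun x => C * expR (- (c / 2 * x)))).
- near=> x; have x0 : 0 <= x by near: x; exact: nbhs_pinfty_ge.
  rewrite /= mulr_ge0 ?exprn_ge0 ?expR_ge0//=.
  have -> : - (c * x) = - (c / 2 * x) + - (c / 2 * x) by field.
  by rewrite expRD mulrA ler_wpM2r ?expR_ge0// bnd.
- exact: cvg_cst.
- rewrite -[X in _ --> X](mulr0 C); apply: cvgMr.
  apply: (@cvg_comp _ _ _ (fun x => c / 2 * x) (fun z => expR (- z)) _ +oo).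
    exact: gt0_cvgMry.
  exact: cvgr_expR.
Unshelve. all: end_near. Qed.

(** Integration by parts carried out on primitives: the next one is
    [- x^(k+1) e^(-c x) / c + (k+1)/c * G]. Normalising to vanish at infinity makes [- G 0] the
    gamma integral. *)
Lemma gamma_primitive (k : nat) (c : R) : 0 < c -> exists G : R -> R,
  [/\ forall x : R, is_derive x (1 : R) G (x ^+ k * expR (- (c * x))),
      G x @[x --> +oo] --> 0 & G 0 = - (k`!%:R / c ^+ k.+1)].
Proof.
move=> c0; have cn0 : c != 0 by rewrite gt_eqF.
elim: k => [|k [G [dG G0 GE]]].
  exists (fun x => - c^-1 * (x ^+ 0 * expR (- (c * x)))); split.
  - move=> x; apply: (is_derive_eq (is_deriveZ (- c^-1) (is_derive_exprn_expR 0 c x))).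
    by rewrite /GRing.scale/= expr0; field.
  - rewrite -[X in _ --> X](mulr0 (- c^-1)); apply: cvgMr.
    exact: (@exprn_expR_cvg0 0%N).
  - by rewrite mulr0 oppr0 expR0 fact0 !mulr1 expr1 mul1r.
exists (fun x => - c^-1 * (x ^+ k.+1 * expR (- (c * x))) + k.+1%:R / c * G x); split.
- move=> x; apply: (is_derive_eq (is_deriveD
    (is_deriveZ (- c^-1) (is_derive_exprn_expR k.+1 c x))
    (is_deriveZ (k.+1%:R / c) (dG x)))).
  by rewrite /GRing.scale/=; move: (k.+1%:R : R) => K; field.
- have := cvgD (cvgM (cvg_cst (- c^-1)) (@exprn_expR_cvg0 k.+1 c c0))
    (cvgM (cvg_cst (k.+1%:R / c)) G0).
  by rewrite !mulr0 addr0; apply; exact: _.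
- rewrite GE expr0n/= mul0r mulr0 add0r factS natrM (exprS c k.+1).
  have := expf_neq0 k.+1 cn0; move: (c ^+ k.+1) (k.+1%:R : R) => t K t0.
  by field; rewrite t0.
Qed.

Lemma integral_gamma (k : nat) (c : R) : 0 < c ->
  (\int[mu]_(x in `[0%R : R, +oo[) (x ^+ k * expR (- (c * x)))%:E =
   (k`!%:R / c ^+ k.+1)%:E)%E.
Proof.
move=> c0; have [G [dG Goo G0]] := gamma_primitive k c0.
have dG1 x : derivable G x 1 by have := dG x => ?; exact: ex_derive.
rewrite (@ge0_continuous_FTC2y _ _ G 0 0)//.
- by rewrite G0 -EFinB sub0r opprK.
- by move=> x x0; rewrite mulr_ge0 ?exprn_ge0 ?expR_ge0.
- apply: derivable_within_continuous => x _.
  by have := is_derive_exprn_expR k c x => ?; exact: ex_derive.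
- apply: cvg_at_right_filter; apply: differentiable_continuous.
  by apply/derivable1_diffP; exact: dG1.
- by move=> x _; rewrite derive1E; have := dG x => ?; exact: derive_val.
Qed.
End gamma_integral.

Ltac solve_ge0 := repeat first
  [ assumption | exact: expR_ge0 | exact: ler0n | exact: ler01
  | (apply: ltW; assumption)
  | apply: mulr_ge0 | apply: addr_ge0 | apply: exprn_ge0 | rewrite invr_ge0 ].

Section half_line.
Context {R : realType}.
Local Notation mu := (@lebesgue_measure R).
Local Notation Rp := (`[0%R : R, +oo[%classic).

(** The point [0] is excluded because integrands containing [/ t] take the value [0] there instead
    of their limit. *)
Lemma eq_integral_pos (f g : R -> R) :
  measurable_fun setT f -> measurable_fun setT g ->
  (forall t, 0 < t -> f t = g t) ->
  (\int[mu]_(t in `[0%R : R, +oo[) (f t)%:E = \int[mu]_(t in `[0%R : R, +oo[) (g t)%:E)%E.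
Proof.
move=> mf mg fg.
rewrite -!(integral_itv_obnd_cbnd (r := 0)).
- by apply: eq_integral => t; rewrite inE/= in_itv/= andbT => t0; rewrite fg.
- by apply: measurable_funTS; exact/measurable_EFinP.
- by apply: measurable_funTS; exact/measurable_EFinP.
Qed.

Lemma integral_nnegZl (k : R) (f : R -> R) : 0 <= k -> measurable_fun setT f ->
  (forall t, 0 <= t -> 0 <= f t) ->
  (\int[mu]_(t in Rp) (k * f t)%:E = k%:E * \int[mu]_(t in Rp) (f t)%:E)%E.
Proof.
move=> k0 mf f0; rewrite -ge0_integralZl//.
- by apply: measurable_funTS; exact/measurable_EFinP.
- by move=> t; rewrite /= in_itv/= andbT lee_fin => /f0.
Qed.

Lemma eq_integral_nneg (f g : R -> R) : (forall t, 0 <= t -> f t = g t) ->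
  (\int[mu]_(t in Rp) (f t)%:E = \int[mu]_(t in Rp) (g t)%:E)%E.
Proof.
by move=> fg; apply: eq_integral => t; rewrite inE/= in_itv/= andbT => /fg ->.
Qed.

Lemma eq_integral_nneg_ereal (f g : R -> \bar R) : (forall t, 0 <= t -> f t = g t) ->
  (\int[mu]_(t in Rp) f t = \int[mu]_(t in Rp) g t)%E.
Proof.
by move=> fg; apply: eq_integral => t; rewrite inE/= in_itv/= andbT => /fg ->.
Qed.

Lemma swap_integral_nneg (f : R -> R -> R) :
  measurable_fun setT (fun z : measurableTypeR R * measurableTypeR R => f z.1 z.2) ->
  (forall x y, 0 <= x -> 0 <= y -> 0 <= f x y) ->
  (\int[mu]_(x in Rp) \int[mu]_(y in Rp) (f x y)%:E =
   \int[mu]_(y in Rp) \int[mu]_(x in Rp) (f x y)%:E)%E.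
Proof.
move=> mf f0; apply: (@fubini_tonelli_setX _ _ _ _ _ mu mu) => //.
by move=> x y; rewrite /= !in_itv/= !andbT; exact: f0.
Qed.

Lemma integral_expR_half_line (c : R) : 0 < c ->
  (\int[mu]_(t in `[0%R : R, +oo[) (expR (- (c * t)))%:E = (c^-1)%:E)%E.
Proof.
move=> c0; have := integral_gamma 0 c0; rewrite fact0 mul1r expr1 => <-.
by apply: eq_integral => t _; rewrite expr0 mul1r.
Qed.

Lemma integral_expR_segment (t S : R) : 0 < t -> 0 < S ->
  (\int[mu]_(u in `[0%R : R, S]) (expR (- (t * u)))%:E =
   ((1 - expR (- (t * S))) / t)%:E)%E.
Proof.
move=> t0 S0.
pose F (u : R) := - t^-1 * expR (- (t * u)).
have dF u : is_derive u (1 : R) F (expR (- (t * u))).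
  apply: (is_derive_eq (is_deriveZ (- t^-1) (is_derive_expR_scale t u))).
  by rewrite /GRing.scale/=; field; rewrite gt_eqF.
have dF1 u : derivable F u 1 by have := dF u => ?; exact: ex_derive.
have cF u : {for u, continuous F}.
  by apply: differentiable_continuous; apply/derivable1_diffP; exact: dF1.
rewrite (@continuous_FTC2 _ _ F)//.
- rewrite /F mulr0 oppr0 expR0 mulr1 -EFinB; congr EFin.
  by field; rewrite gt_eqF.
- apply: derivable_within_continuous => u _.
  by have := is_derive_expR_scale t u => ?; exact: ex_derive.
- split=> [u _||]; first exact: dF1.
    by apply: cvg_at_right_filter; exact: cF.
  by apply: cvg_at_left_filter; exact: cF.
- by move=> u _; rewrite derive1E; have := dF u => ?; exact: derive_val.
Qed.

Lemma integral_inv_segment (c S : R) : 0 < c -> 0 < S ->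
  (\int[mu]_(u in `[0%R : R, S]) ((c + u)^-1)%:E = (ln (c + S) - ln c)%:E)%E.
Proof.
move=> c0 S0.
have dcu u : is_derive u (1 : R) (fun v : R => c + v) 1.
  apply: (is_derive_eq (is_deriveD (is_derive_cst c u (1 : R)) (is_derive_id u (1 : R)))).
  by rewrite add0r.
have dF (u : R) : 0 <= u -> is_derive u (1 : R) (fun v : R => ln (c + v)) (c + u)^-1.
  move=> u0; have cu : 0 < c + u by lra.
  by apply: (is_derive_eq (is_derive1_comp (is_derive1_ln cu) (dcu u))); rewrite mulr1.
have dF1 u : 0 <= u -> derivable (fun v : R => ln (c + v)) u 1.
  by move=> /dF u0; exact: ex_derive.
have cF u : 0 <= u -> {for u, continuous (fun v : R => ln (c + v))}.
  by move=> u0; apply: differentiable_continuous; apply/derivable1_diffP; exact: dF1.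
rewrite (@continuous_FTC2 _ _ (fun v : R => ln (c + v)))//.
- by rewrite addr0 EFinB.
- apply: derivable_within_continuous => u; rewrite in_itv/= => /andP[u0 _].
  have cu : c + u != 0 by rewrite gt_eqF//; lra.
  by have := is_deriveV cu (dcu u) => ?; exact: ex_derive.
- split=> [u||]; rewrite ?in_itv/=.
  + by move=> /andP[/ltW u0 _]; exact: dF1.
  + by apply: cvg_at_right_filter; exact: cF.
  + by apply: cvg_at_left_filter; apply: cF; exact: ltW.
- move=> u; rewrite in_itv/= => /andP[/ltW u0 _].
  by rewrite derive1E; have := dF u u0 => ?; exact: derive_val.
Qed.

(* At [t = 0] the integrand has the junk value [0], on a null set. *)
Lemma ln1p_sinr_laplace (S I : R) : 0 <= S -> 0 <= I ->
  (\int[mu]_(t in `[0%R : R, +oo[)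
     (expR (- t) * expR (- (t * I)) * ((1 - expR (- (t * S))) / t))%:E
   = (ln (1 + S / (1 + I)))%:E)%E.
Proof.
rewrite le_eqVlt => /predU1P[<- I0|S0 I0].
  under eq_integral do rewrite mulr0 oppr0 expR0 subrr mul0r mulr0.
  by rewrite integral0 mul0r addr0 ln1.
have I1 : 0 < 1 + I by lra.
(* Frullani's argument: [(1 - e^(-t S)) / t] is the integral of [e^(-t u)] over [[0, S]]; after the
   exchange, the integral in [t] leaves [1 / (1 + I + u)]. *)
transitivity (\int[mu]_(t in `]0%R : R, +oo[) \int[mu]_(u in `[0%R : R, S])
   (expR (- ((1 + I + u) * t)))%:E)%E.
  rewrite -(integral_itv_obnd_cbnd (r := 0)); last first.
    by apply: measurable_funTS; apply/measurable_EFinP; solve_measurable.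
  apply: eq_integral => t; rewrite inE/= in_itv/= andbT => t0.
  transitivity (\int[mu]_(u in `[0%R : R, S])
     ((expR (- t) * expR (- (t * I)))%:E * (expR (- (t * u)))%:E))%E.
    rewrite ge0_integralZl//=; last 1 first.
      by apply: measurable_funTS; apply/measurable_EFinP; solve_measurable.
    by rewrite integral_expR_segment.
  apply: eq_integral => u _; rewrite -EFinM -!expRD; congr (expR _)%:E; ring.
rewrite (@fubini_tonelli_setX _ _ _ _ _ mu mu _ _
  (fun t u => expR (- ((1 + I + u) * t))))//=; last 1 first.
  by solve_measurable.
transitivity (\int[mu]_(u in `[0%R : R, S]) ((1 + I + u)^-1)%:E)%E.
  apply: eq_integral => u; rewrite inE/= in_itv/= => /andP[u0 _].
  rewrite integral_itv_obnd_cbnd; last first.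
    by apply: measurable_funTS; apply/measurable_EFinP; solve_measurable.
  by rewrite integral_expR_half_line//; lra.
rewrite integral_inv_segment// -ln_div ?posrE//; last by lra.
by congr (ln _)%:E; field; rewrite gt_eqF.
Qed.
End half_line.

(** * Geometric expansion and incomplete gamma functions *)

Section rate_integrals.
Context {R : realType}.
Local Notation mu := (@lebesgue_measure R).
Local Notation Rp := (`[0%R : R, +oo[%classic).

(** With [y = 1 / (1 + g t)], one has [1 - y^M = (1 - y) (1 + y + ... + y^(M-1))] and
    [(1 - y) / t = g y] for [t > 0]. *)
Lemma geometric_sum_integral (g : R) (M : nat) (h : R -> R) : 0 < g ->
  measurable_fun setT h -> (forall t, 0 <= t -> 0 <= h t) ->
  (\int[mu]_(t in Rp) (expR (- t) * h t * ((1 - (1 + g * t) ^- M) / t))%:E =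
   \sum_(i < M) \int[mu]_(t in Rp) (g * expR (- t) * h t / (1 + g * t) ^+ i.+1)%:E)%E.
Proof.
move=> g0 mh h0; rewrite -ge0_integral_sum//; last 2 first.
- move=> i; apply: measurable_funTS; apply/measurable_EFinP; solve_measurable.
- move=> i t; rewrite /= in_itv/= andbT lee_fin => t0.
  rewrite !mulr_ge0 ?expR_ge0 ?h0 ?(ltW g0)// invr_ge0 exprn_ge0//.
  by rewrite addr_ge0// mulr_ge0// ltW.
under [RHS]eq_integral do rewrite sumEFin.
apply: eq_integral_pos.
- solve_measurable.
- apply: measurable_sum => i; solve_measurable.
- move=> t t0; have y0 : 1 + g * t != 0 by rewrite gt_eqF// addr_gt0// mulr_gt0.
  have -> : (1 - (1 + g * t) ^- M) / t = \sum_(i < M) g / (1 + g * t) ^+ i.+1.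
    rewrite -exprVn -opprB subrX1 -mulNr opprB mulrAC.
    have -> : (1 - (1 + g * t)^-1) / t = g * (1 + g * t)^-1.
      by field; rewrite y0 gt_eqF.
    by rewrite mulr_sumr; apply: eq_bigr => i _; rewrite -mulrA -exprS exprVn.
  by rewrite mulr_sumr; apply: eq_bigr => i _; ring.
Qed.

(** The substitution [x = t + 1/g] turns [1 + g t] into [g x] and [e^(-t)] into [e^(1/g) e^(-x)]. *)
Lemma integral_incgamma (g : R) (i : nat) : 0 < g ->
  (\int[mu]_(t in Rp) (g * expR (- t) / (1 + g * t) ^+ i.+1)%:E =
   (expR g^-1 * (incgamma_negnat i g^-1 / g ^+ i))%:E)%E.
Proof.
move=> g0; have gn0 : g != 0 by rewrite gt_eqF.
pose G (x : R) := x ^- i.+1 * expR (- x).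
have D1 (t : R) : ((fun t : R => t + g^-1)^`())%classic t = 1.
  by rewrite derive1E deriveD// derive_id derive_cst addr0.
have D1f : ((fun t : R => t + g^-1)^`())%classic = (fun _ : R => 1 : R).
  exact/funext.
have dG (x : R) : 0 < x -> derivable G x 1.
  move=> x0.
  have xn0 : x ^+ i.+1 != 0 by rewrite expf_neq0// gt_eqF.
  have dN : is_derive x (1 : R) (fun y : R => - y) (- 1) by exact: is_deriveNid.
  have dV := @is_deriveV R (fun y => y ^+ i.+1) _ _ _ xn0 (is_derive_exprn i.+1 x).
  have := is_deriveM dV (is_derive1_comp (is_derive_expR _) dN).
  by move=> ?; exact: ex_derive.
have incE : (\int[mu]_(x in `[(g^-1)%R, +oo[) (G x)%:E =
    (g ^+ i * expR (- g^-1))%:E *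
    \int[mu]_(t in Rp) (g * expR (- t) / (1 + g * t) ^+ i.+1)%:E)%E.
  have := @increasing_ge0_integration_by_substitutiony R (fun t => t + g^-1) G 0.
  rewrite add0r => ->.
  - rewrite -integral_nnegZl.
    + apply: eq_integral_nneg => t t0; rewrite mulrfctE D1 /= /G mulr1 opprD expRD.
      have -> : 1 + g * t = g * (t + g^-1) by field.
      rewrite exprMn.
      have : (t + g^-1) ^+ i.+1 != 0.
        by rewrite expf_neq0// gt_eqF// ltr_wpDl// invr_gt0.
      have := expf_neq0 i gn0; rewrite (exprS g).
      by move: ((t + g^-1) ^+ i.+1) (g ^+ i) => u w w0 u0; field; rewrite u0 w0.
    + by rewrite mulr_ge0 ?expR_ge0 ?exprn_ge0// ltW.
    + solve_measurable.
    + move=> t t0; rewrite !mulr_ge0 ?expR_ge0 ?(ltW g0)//.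
      by rewrite invr_ge0 exprn_ge0// addr_ge0// mulr_ge0// ltW.
  - by move=> x y _ _ xy; rewrite ltrD2r.
  - by move=> x _; rewrite D1f; exact: cvg_cst.
  - by rewrite D1f; exact: is_cvg_cst.
  - by rewrite D1f; exact: is_cvg_cst.
  - split; first by move=> x _; exact: ex_derive.
    by apply: cvg_at_right_filter; apply: cvgD; [exact: cvg_id|exact: cvg_cst].
  - exact: cvg_addrr.
  - apply: derivable_within_continuous => x; rewrite in_itv/= andbT => gx.
    by apply: dG; apply: lt_le_trans gx; rewrite invr_gt0.
  - move=> x; rewrite in_itv/= andbT => gx.
    have x0 : 0 < x by apply: lt_trans gx; rewrite invr_gt0.
    by rewrite mulr_ge0 ?expR_ge0// invr_ge0 exprn_ge0// ltW.
set J := (X in X = _).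
have J0 : (0 <= J)%E.
  apply: integral_ge0 => t; rewrite /= in_itv/= andbT lee_fin => t0.
  rewrite !mulr_ge0 ?expR_ge0 ?(ltW g0)//.
  by rewrite invr_ge0 exprn_ge0// addr_ge0// mulr_ge0// ltW.
(* [incgamma_negnat] is a [fine], so finiteness must be known; the integrand is dominated by
   [g e^(-t)]. *)
have Jfin : J \is a fin_num.
  rewrite ge0_fin_numE//; apply: (@le_lt_trans _ _ (g * 1^-1)%:E); last exact: ltry.
  rewrite EFinM -integral_expR_half_line// -(integral_nnegZl (ltW g0)).
  apply: ge0_le_integral => //.
  - move=> t; rewrite /= in_itv/= andbT lee_fin => t0.
    rewrite !mulr_ge0 ?expR_ge0 ?(ltW g0)//.
    by rewrite invr_ge0 exprn_ge0// addr_ge0// mulr_ge0// ltW.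
  - by apply: measurable_funTS; apply/measurable_EFinP; solve_measurable.
  - by apply: measurable_funTS; apply/measurable_EFinP; solve_measurable.
  - move=> t; rewrite /= in_itv/= andbT lee_fin mul1r => t0.
    rewrite ler_piMr ?mulr_ge0 ?expR_ge0 ?(ltW g0)// invf_le1.
      by rewrite exprn_ege1// lerDl mulr_ge0// ltW.
    by rewrite exprn_gt0// ltr_wpDr// mulr_ge0// ltW.
  - by solve_measurable.
  - by move=> t _; exact: expR_ge0.
rewrite /incgamma_negnat incE fineM// -(fineK Jfin); congr EFin.
rewrite /= expRN; have := expf_neq0 i gn0; have := expR_gt0 g^-1.
move: (g ^+ i) (expR _) (fine J) => u w j w0 u0.
by field; rewrite u0 gt_eqF.
Qed.
End rate_integrals.

(** * Reduction of the interference-limited integrals to [I1] *)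

Section interference_integral.
Context {R : realType}.
Local Notation mu := (@lebesgue_measure R).
Local Notation Rp := (`[0%R : R, +oo[%classic).

Variables (g1 g2 : R) (i : nat).
Hypotheses (g1_gt0 : 0 < g1) (g2_gt0 : 0 < g2).

Let g1n : g1 != 0. Proof. by rewrite gt_eqF. Qed.
Let g2n : g2 != 0. Proof. by rewrite gt_eqF. Qed.
Let g1V : 0 < g1^-1. Proof. by rewrite invr_gt0. Qed.
Let b_gt0 : 0 < g1 / g2. Proof. exact: divr_gt0. Qed.

(* Both sides of [integral_I1] are double integrals: [K] comes from writing
   [1 / (1 + g2 * t)] as an integral of [expR (- ((g1 / g2 + g1 * t) * v))] over [v],
   and [L] from writing each [1 / (x + g1 / g2) ^+ l.+1] as a gamma integral in [v]
   and summing over [l] with the binomial formula. *)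
Let K t v := g1 ^+ 2 / g2 * expR (- t) / (1 + g1 * t) ^+ i.+1 *
  expR (- ((g1 / g2 + g1 * t) * v)).
Let kappa v := g1 / (g1 ^+ i * g2 * i`!%:R) * expR (- (g1 / g2 * v)) * (1 + g1 * v) ^+ i.
Let L x v := kappa v * (x ^+ i * expR (- ((g1^-1 + v) * x))) / (x + 1).

(** The exponent is scaled by [g1], using [(g1 / g2) (1 + g2 t) = g1 / g2 + g1 t], so that the shift
    [g1 / g2] of [I1] appears. *)
Let K_in_v t : 0 <= t ->
  (\int[mu]_(v in Rp) (K t v)%:E =
   (g1 * expR (- t) * (1 + g2 * t)^-1 / (1 + g1 * t) ^+ i.+1)%:E)%E.
Proof.
move=> t0; have bt : 0 < g1 / g2 + g1 * t by rewrite ltr_wpDr// mulr_ge0// ltW.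
rewrite integral_nnegZl; first last.
- by move=> v _; exact: expR_ge0.
- by solve_measurable.
- by solve_ge0.
rewrite integral_expR_half_line// -EFinM; congr EFin.
have : (1 + g1 * t) ^+ i.+1 != 0.
  by rewrite expf_neq0// gt_eqF// ltr_wpDr// mulr_ge0// ltW.
have : 1 + g2 * t != 0 by rewrite gt_eqF// ltr_wpDr// mulr_ge0// ltW.
have -> : g1 / g2 + g1 * t = g1 * (1 + g2 * t) / g2 by field.
by move: (_ ^+ i.+1) => u h u0; field; rewrite u0 h g1n g2n.
Qed.

(** Two evaluations of one double integral: in [t] it produces the factor [1 / (x + 1)], in [x] a
    gamma integral produces the power [1 / (1 + g1 t)^(i+1)]. *)
Let K_in_t v : 0 <= v ->
  (\int[mu]_(t in Rp) (K t v)%:E = \int[mu]_(x in Rp) (L x v)%:E)%E.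
Proof.
move=> v0; pose c := 1 + g1 * v.
have c0 : 0 < c by rewrite ltr_wpDr// mulr_ge0// ltW.
have cn : c != 0 by rewrite gt_eqF.
have av : g1^-1 + v = c / g1 by rewrite /c; field.
have kv : 0 <= kappa v by rewrite /kappa; solve_ge0.
(* [1 / (x + 1)] is written with the factor [c], which avoids rescaling [t] later. *)
pose N x t := kappa v * c * (x ^+ i * expR (- ((c / g1 + c * t) * x))) * expR (- (c * t)).
transitivity (\int[mu]_(x in Rp) \int[mu]_(t in Rp) (N x t)%:E)%E; last first.
  apply: eq_integral_nneg_ereal => x x0; rewrite /L av.
  have x1 : 0 < c * (1 + x) by rewrite mulr_gt0// ltr_wpDr.
  have Nx t : 0 <= t -> N x t = kappa v * c * (x ^+ i * expR (- (c / g1 * x))) *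
      expR (- (c * (1 + x) * t)).
    move=> _; have e1 : expR (- ((c / g1 + c * t) * x)) * expR (- (c * t)) =
        expR (- (c / g1 * x)) * expR (- (c * (1 + x) * t)).
      by rewrite -!expRD; congr expR; ring.
    rewrite /N -mulrA -[X in _ * X]mulrA e1; ring.
  rewrite (eq_integral_nneg Nx) integral_nnegZl; first last.
  - by move=> t _; exact: expR_ge0.
  - by solve_measurable.
  - by solve_ge0; rewrite ltW.
  rewrite integral_expR_half_line// -EFinM; congr EFin.
  by rewrite (addrC x); field; rewrite cn gt_eqF// ltr_wpDr.
rewrite swap_integral_nneg; first last.
- by move=> x t x0 t0; rewrite /N; solve_ge0.
- by rewrite /N; solve_measurable.
apply: eq_integral_nneg_ereal => t t0.
have Nt x : 0 <= x -> N x t = kappa v * c * expR (- (c * t)) *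
    (x ^+ i * expR (- ((c / g1 + c * t) * x))) by move=> _; rewrite /N; ring.
have ct : 0 < c / g1 + c * t by rewrite ltr_wpDr ?divr_gt0// mulr_ge0// ltW.
rewrite (eq_integral_nneg Nt) integral_nnegZl; first last.
- by move=> x x0; solve_ge0.
- by solve_measurable.
- by solve_ge0.
rewrite integral_gamma// -EFinM; congr EFin.
have g1t : 1 + g1 * t != 0 by rewrite gt_eqF// ltr_wpDr// mulr_ge0// ltW.
have -> : c / g1 + c * t = c * (1 + g1 * t) / g1 by field.
have -> : K t v = g1 ^+ 2 / g2 / (1 + g1 * t) ^+ i.+1 *
    (expR (- (g1 / g2 * v)) * expR (- (c * t))).
  have e1 : expR (- (g1 / g2 * v)) * expR (- (c * t)) =
      expR (- t) * expR (- ((g1 / g2 + g1 * t) * v)).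
    by rewrite -!expRD; congr expR; rewrite /c; ring.
  by rewrite /K e1; ring.
have fn : i`!%:R != 0 :> R by rewrite pnatr_eq0 -lt0n fact_gt0.
rewrite /kappa -/c !exprMn exprVn !(exprS _ i).
have := expf_neq0 i g1n; have := expf_neq0 i g1t; have := expf_neq0 i cn.
move: (g1 ^+ i) ((1 + g1 * t) ^+ i) (c ^+ i) (i`!%:R : R) fn => u w z f f0 z0 w0 u0.
by field; rewrite f0 z0 w0 u0 g1t cn g1n g2n.
Qed.

(** The coefficients of [R_I2] originate here: the binomial weight, the [l!] of the gamma integral
    and the [1 / i!] in [kappa] combine to [1 / (i - l)!], while [g1 * g1^l / g1^i] gives the
    possibly negative exponent. *)
Let L_in_v x : 0 <= x ->
  (\int[mu]_(v in Rp) (L x v)%:E =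
   \sum_(l < i.+1) (g1 ^ ((l.+1)%:Z - (i : nat)%:Z) / (g2 * ((i - l)`!)%:R) *
    (x ^+ i * expR (- (g1^-1 * x)) / ((x + g1 / g2) ^+ l.+1 * (x + 1))))%:E)%E.
Proof.
move=> x0.
have xb : 0 < g1 / g2 + x by rewrite ltr_wpDr.
pose coef (l : nat) := g1 / (g1 ^+ i * g2 * i`!%:R) * 'C(i, l)%:R * g1 ^+ l *
  (x ^+ i * expR (- (g1^-1 * x))) / (x + 1).
have coef0 l : 0 <= coef l by rewrite /coef; solve_ge0.
transitivity (\int[mu]_(v in Rp) (\sum_(l < i.+1)
   (coef l * (v ^+ l * expR (- ((g1 / g2 + x) * v))))%:E))%E.
  apply: eq_integral_nneg_ereal => v v0; rewrite sumEFin; congr EFin.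
  rewrite /L /kappa exprDn.
  rewrite mulr_sumr !mulr_suml; apply: eq_bigr => l _.
  rewrite expr1n mul1r -[_ *+ 'C(i, l)]mulr_natr exprMn /coef.
  have -> : expR (- ((g1 / g2 + x) * v)) = expR (- (g1 / g2 * v)) * expR (- (v * x)).
    by rewrite -expRD; congr expR; ring.
  have -> : expR (- ((g1^-1 + v) * x)) = expR (- (g1^-1 * x)) * expR (- (v * x)).
    by rewrite -expRD; congr expR; ring.
  ring.
rewrite ge0_integral_sum//; last 2 first.
- by move=> l; apply: measurable_funTS; apply/measurable_EFinP; solve_measurable.
- move=> l v; rewrite /= in_itv/= andbT lee_fin => v0.
  by have := coef0 l; move=> ?; solve_ge0.
apply: eq_bigr => l _; rewrite integral_nnegZl//; first last.
- by move=> v v0; solve_ge0.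
- by solve_measurable.
rewrite integral_gamma// -EFinM; congr EFin.
have li : (l <= i)%N by rewrite -ltnS.
have fE : i`!%:R = 'C(i, l)%:R * (l`!%:R * (i - l)`!%:R) :> R.
  by rewrite -!natrM bin_fact.
rewrite /coef fE expfzDr// -exprnN -exprnP (addrC x (g1 / g2)) (exprS g1 l).
have l0 : l`!%:R != 0 :> R by rewrite pnatr_eq0 -lt0n fact_gt0.
have il0 : (i - l)`!%:R != 0 :> R by rewrite pnatr_eq0 -lt0n fact_gt0.
have bn0 : 'C(i, l)%:R != 0 :> R by rewrite pnatr_eq0 -lt0n bin_gt0.
have xbl : (g1 / g2 + x) ^+ l.+1 != 0 by rewrite expf_neq0// gt_eqF.
have x1 : x + 1 != 0 by rewrite gt_eqF// ltr_wpDl.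
have := expf_neq0 i g1n.
move: ((_ + _) ^+ _) xbl (l`!%:R : R) l0 ((i - l)`!%:R : R) il0 ('C(i, l)%:R : R) bn0
  => u u0 f1 f10 f2 f20 bc bc0.
move: (expR _) (g1 ^+ l) (g1 ^+ i) (x ^+ i) => e gl gi xi gi0.
by field; rewrite u0 f10 f20 bc0 gi0 g2n x1.
Qed.

Lemma integral_I1 :
  (\int[mu]_(t in Rp) (g1 * expR (- t) * (1 + g2 * t)^-1 / (1 + g1 * t) ^+ i.+1)%:E =
   (\sum_(l < i.+1) g1 ^ ((l.+1)%:Z - (i : nat)%:Z) / (g2 * ((i - l)`!)%:R) *
      I1 g1^-1 (g1 / g2) i l.+1)%:E)%E.
Proof.
rewrite -(eq_integral_nneg_ereal K_in_v) swap_integral_nneg; first last.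
- by move=> t v t0 v0; rewrite /K; solve_ge0.
- by rewrite /K; solve_measurable.
rewrite (eq_integral_nneg_ereal K_in_t) swap_integral_nneg; first last.
- by move=> v x v0 x0; rewrite /L /kappa; solve_ge0.
- by rewrite /L /kappa; solve_measurable.
rewrite (eq_integral_nneg_ereal L_in_v) ge0_integral_sum//; last 2 first.
- by move=> l; apply: measurable_funTS; apply/measurable_EFinP; solve_measurable.
- move=> l x; rewrite /= in_itv/= andbT lee_fin => x0.
  by have := exprz_ge0 (l.+1%:Z - i%:Z) (ltW g1_gt0); move=> ?; solve_ge0.
rewrite -sumEFin; apply: eq_bigr => l _; rewrite integral_nnegZl; first last.
- by move=> x x0; solve_ge0.
- by solve_measurable.
- by have := exprz_ge0 (l.+1%:Z - i%:Z) (ltW g1_gt0); move=> ?; solve_ge0.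
(* To remove the [fine] of [I1], its integrand is bounded through [(x + b)^(l+1) (x + 1) >= b^(l+1)]
   with [b = g1 / g2], which leaves a gamma integral. *)
rewrite [RHS]EFinM /I1; congr (_ * _)%E; rewrite fineK//.
rewrite ge0_fin_numE; last first.
  by apply: integral_ge0 => x; rewrite /= in_itv/= andbT lee_fin => x0; solve_ge0.
apply: (@le_lt_trans _ _ (((g1 / g2) ^- l.+1)%:E *
    \int[mu]_(x in Rp) (x ^+ i * expR (- (g1^-1 * x)))%:E)%E); last first.
  by rewrite integral_gamma// -EFinM ltry.
rewrite -integral_nnegZl; first last.
- by move=> x x0; solve_ge0.
- by solve_measurable.
- by solve_ge0.
apply: ge0_le_integral => //.
- by move=> x; rewrite /= in_itv/= andbT lee_fin => x0; solve_ge0.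
- by apply: measurable_funTS; apply/measurable_EFinP; solve_measurable.
- by apply: measurable_funTS; apply/measurable_EFinP; solve_measurable.
- move=> x; rewrite /= in_itv/= andbT lee_fin => x0.
  rewrite mulrC ler_wpM2r//; first by solve_ge0.
  have bl : 0 < (g1 / g2) ^+ l.+1 by rewrite exprn_gt0.
  rewrite lef_pV2 ?posrE ?mulr_gt0 ?exprn_gt0 ?ltr_wpDl//.
  rewrite -[leLHS]mulr1; apply: ler_pM => //; first exact: ltW.
    by rewrite lerXn2r ?nnegrE ?addr_ge0 ?(ltW b_gt0)// lerDr.
  by rewrite lerDr.
Qed.
End interference_integral.

(** * Ergodic rates from Laplace transforms *)

Section expected_rate.
Context (R : realType) d (T : measurableType d) (P : probability T R).
Local Notation mu := (@lebesgue_measure R).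
Local Notation Rp := (`[0%R : R, +oo[%classic).

(** After exchanging expectation and [t]-integral, the inner expectation is a difference of two
    finite Laplace transforms, equal to [h t (1 - (1 + g t)^-M)], to which the geometric expansion
    applies. *)
Lemma expected_ln1p_sinr (S I : T -> R) (g : R) (h : R -> R) (M : nat) :
  measurable_fun setT S -> measurable_fun setT I ->
  (forall w, 0 <= S w) -> (forall w, 0 <= I w) -> 0 < g ->
  measurable_fun setT h -> (forall t, 0 <= t -> 0 <= h t) ->
  (forall t, 0 <= t -> (\int[P]_w (expR (- (t * I w)))%:E = (h t)%:E)%E) ->
  (forall t, 0 <= t -> (\int[P]_w (expR (- (t * I w + t * S w)))%:E =
     (h t * (1 + g * t) ^- M)%:E)%E) ->
  (\int[P]_w (ln (1 + S w / (1 + I w)))%:E =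
   \sum_(i < M) \int[mu]_(t in Rp) (g * expR (- t) * h t / (1 + g * t) ^+ i.+1)%:E)%E.
Proof.
move=> mS mI S0 I0 g0 mh h0 hI hIS.
pose k w t := expR (- t) * expR (- (t * I w)) * ((1 - expR (- (t * S w))) / t).
have k0 w t : 0 <= t -> 0 <= k w t.
  move=> t0; rewrite /k mulr_ge0 ?mulr_ge0 ?expR_ge0 ?invr_ge0//.
  by rewrite subr_ge0 -[leRHS]expR0 ler_expR oppr_le0 mulr_ge0.
under eq_integral => w _ do rewrite -ln1p_sinr_laplace//.
rewrite (@fubini_tonelli_setX _ _ _ _ _ P mu setT Rp k)//; first last.
- by move=> w t _; rewrite /= in_itv/= andbT; exact: k0.
- rewrite /k.
  have mS1 := measurableT_comp mS (@measurable_fst _ _ T (measurableTypeR R)).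
  have mI1 := measurableT_comp mI (@measurable_fst _ _ T (measurableTypeR R)).
  by solve_measurable.
rewrite -geometric_sum_integral//.
apply: eq_integral => t; rewrite inE/= in_itv/= andbT => t0.
have Hint (f : T -> R) (c : R) : measurable_fun setT f -> (forall w, 0 <= f w) ->
    (\int[P]_w (f w)%:E = c%:E)%E -> P.-integrable setT (EFin \o f).
  move=> mf f0 fc; apply/integrableP; split; first exact/measurable_EFinP.
  under eq_integral => w _ do rewrite /= ger0_norm//.
  by rewrite fc ltry.
have -> : (\int[P]_w (k w t)%:E = \int[P]_w ((expR (- t) / t)%:E *
   ((expR (- (t * I w)))%:E - (expR (- (t * I w + t * S w)))%:E)))%E.
  apply: eq_integral => w _; rewrite -EFinB -EFinM; congr EFin.
  by rewrite /k opprD expRD; ring.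
have i1 : P.-integrable setT (fun w => (expR (- (t * I w)))%:E).
  apply: (Hint _ _ _ _ (hI t t0)); first by solve_measurable.
  by move=> w; exact: expR_ge0.
have i2 : P.-integrable setT (fun w => (expR (- (t * I w + t * S w)))%:E).
  apply: (Hint _ _ _ _ (hIS t t0)); first by solve_measurable.
  by move=> w; exact: expR_ge0.
rewrite integralZl//; last exact: integrableB.
rewrite integralB// hI// hIS// -EFinB -EFinM; congr EFin; ring.
Qed.
End expected_rate.

(** * Precoders *)

Section precoders.
Local Open Scope complex_scope.
Variables (R : realType) (n : nat).
Implicit Types (u v w : 'cV[R[i]]_n) (z : R[i]).

Lemma abs2E z : (abs2 z)%:C = conjc z * z.
Proof.
case: z => a b; apply/eqP; rewrite eq_complex /abs2/=.
by apply/andP; split; apply/eqP; ring.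
Qed.

Lemma abs2_ge0 z : 0 <= abs2 z. Proof. by rewrite addr_ge0 ?sqr_ge0. Qed.

Lemma abs2_real (r : R) : abs2 r%:C = r ^+ 2.
Proof. by rewrite /abs2/= expr0n addr0. Qed.

Lemma abs2M z1 z2 : abs2 (z1 * z2) = abs2 z1 * abs2 z2.
Proof. by case: z1 z2 => [a b] [c e]; rewrite /abs2/=; ring. Qed.

Lemma csqnorm_ge0 u : 0 <= csqnorm u.
Proof. by apply: sumr_ge0 => k _; exact: abs2_ge0. Qed.

Lemma csqnormE u : (csqnorm u)%:C = cdot u u.
Proof. by rewrite rmorph_sum; apply: eq_bigr => k _; exact: abs2E. Qed.

Lemma csqnorm_eq0 u : csqnorm u = 0 -> u = 0.
Proof.
move=> u0; apply/matrixP => k j; rewrite (ord1 j) mxE.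
have /eqP := u0; rewrite psumr_eq0; last by move=> *; exact: abs2_ge0.
move=> /allP /(_ k (mem_index_enum _)) /=; rewrite paddr_eq0 ?sqr_ge0//.
by rewrite !sqrf_eq0; case: (u k 0) => a b /= /andP[/eqP -> /eqP ->].
Qed.

Lemma cdotC u v : conjc (cdot u v) = cdot v u.
Proof.
rewrite /cdot rmorph_sum; apply: eq_bigr => k _.
by rewrite rmorphM /= conjcK mulrC.
Qed.

Lemma cdotBr u v w : cdot u (v - w) = cdot u v - cdot u w.
Proof. by rewrite /cdot -sumrB; apply: eq_bigr => k _; rewrite !mxE mulrBr. Qed.

Lemma cdotZr u z v : cdot u (z *: v) = z * cdot u v.
Proof. by rewrite /cdot mulr_sumr; apply: eq_bigr => k _; rewrite !mxE mulrCA. Qed.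

Lemma csqnormZ z u : csqnorm (z *: u) = abs2 z * csqnorm u.
Proof. by rewrite /csqnorm mulr_sumr; apply: eq_bigr => k _; rewrite !mxE abs2M. Qed.

Lemma abs2_cdot_cnormalize u v :
  abs2 (cdot u (cnormalize v)) = (csqnorm v)^-1 * abs2 (cdot u v).
Proof.
by rewrite /cnormalize cdotZr abs2M abs2_real exprVn sqr_sqrtr ?csqnorm_ge0.
Qed.

Lemma csqnorm_cnormalize u : u != 0 -> csqnorm (cnormalize u) = 1.
Proof.
move=> u0; rewrite /cnormalize csqnormZ abs2_real exprVn sqr_sqrtr ?csqnorm_ge0//.
by rewrite mulVf//; apply: contra u0 => /eqP /csqnorm_eq0 ->.
Qed.

Lemma signal_BF u : abs2 (cdot u (f_BF u)) = csqnorm u.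
Proof.
rewrite abs2_cdot_cnormalize -csqnormE abs2_real.
have [->|u0] := eqVneq (csqnorm u) 0; first by rewrite expr0n mulr0.
by rewrite expr2 mulKf.
Qed.

Let projection u v : 'cV[R[i]]_n := v - (((csqnorm u)^-1)%:C * cdot u v) *: u.

Let f_IC_projection u v : f_IC u v = cnormalize (projection u v).
Proof.
rewrite /f_IC /projection; congr cnormalize.
rewrite mulmxBl mul1mx -scalemxAl -mulmxA -scalerA; congr (_ - _ *: _).
apply/matrixP => k j; rewrite (ord1 j) !mxE big_ord1 !mxE mulrC; congr (_ * _).
by apply: eq_bigr => l _; rewrite !mxE.
Qed.

(** The case [u = 0] is covered as well, so the interference vanishes at every sample point and not
    only almost surely. *)
Lemma interference_IC u v : cdot u (f_IC u v) = 0.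
Proof.
rewrite f_IC_projection /cnormalize cdotZr /projection cdotBr cdotZr -csqnormE.
have [u0|u0] := eqVneq (csqnorm u) 0.
  suff -> : cdot u v = 0 by rewrite !(mulr0, mul0r) subrr mulr0.
  by rewrite (csqnorm_eq0 u0) /cdot big1// => k _; rewrite mxE conjc0 mul0r.
rewrite mulrAC -rmorphM /= mulVf// mul1r subrr mulr0//.
Qed.

(** For the orthogonal projection [w] of [v], the inner product of [v] and [w] is [|w|^2], so the
    power along [w / |w|] is [|w|^2]; Pythagoras gives the difference. This exhibits the power as a
    quadratic form in [v] involving only the direction of [u]. *)
Lemma signal_IC u v :
  abs2 (cdot v (f_IC u v)) = csqnorm v - abs2 (cdot v (cnormalize u)).
Proof.
rewrite f_IC_projection !abs2_cdot_cnormalize.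
set c := (csqnorm u)^-1.
(* This form of [c = 1 / |u|^2] survives [u = 0], where [c] is [0]. *)
have cc : c * c * csqnorm u = c.
  rewrite /c; have [->|u0] := eqVneq (csqnorm u) 0; first by rewrite invr0 !mul0r.
  by rewrite -mulrA mulVf// mulr1.
pose p := csqnorm v - c * abs2 (cdot v u).
have dot_p : cdot v (projection u v) = p%:C.
  rewrite /projection cdotBr cdotZr -csqnormE /p rmorphB rmorphM /= abs2E cdotC.
  by rewrite mulrA.
have wv : cdot (projection u v) v = p%:C by rewrite -cdotC dot_p conjc_real.
have wu : cdot (projection u v) u =
    conjc (cdot u v) - c%:C * conjc (cdot u v) * (csqnorm u)%:C.
  rewrite -cdotC /projection cdotBr cdotZr -csqnormE rmorphB !rmorphM /=.
  by rewrite !oppr0.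
have norm_p : csqnorm (projection u v) = p.
  apply: complexI; rewrite csqnormE {2}/projection cdotBr cdotZr wv wu.
  set z := cdot u v; have cc' : c%:C * c%:C * (csqnorm u)%:C = c%:C.
    by rewrite -!rmorphM /= cc.
  rewrite -[RHS]subr0; congr (_ - _).
  transitivity (z * conjc z * (c%:C - c%:C * c%:C * (csqnorm u)%:C)); first by ring.
  by rewrite cc' subrr mulr0.
rewrite dot_p norm_p abs2_real -/p.
have [->|p0] := eqVneq p 0; first by rewrite expr0n mulr0.
by rewrite expr2 mulKf.
Qed.
End precoders.

(** * Signal and interference powers as functions of the real coordinates *)

Section channels.
Context (R : realType) (n : nat).
Implicit Types (x : chan_index n -> R) (i j : 'I_2).

(** A version of [chan] on bare families of reals, to which [update] applies; [chan X i j w] is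
    convertible to [chan_vec (X ^~ w) i j]. *)
Definition chan_vec x i j : 'cV[R[i]]_n :=
  \col_k Complex (x (i, j, k, false)) (x (i, j, k, true)).

Lemma chan_vec_update x i j i' j' k b v : (i, j) != (i', j') ->
  chan_vec (update x (i, j, k, b) v) i' j' = chan_vec x i' j'.
Proof.
move=> ij; apply/matrixP => l c; rewrite !mxE /update !xpair_eqE.
by move: ij; rewrite eq_sym xpair_eqE => /negbTE ->.
Qed.

Lemma csqnorm_chan_vec x i j : csqnorm (chan_vec x i j) =
  \sum_(k < n) (x (i, j, k, false) ^+ 2 + x (i, j, k, true) ^+ 2).
Proof. by apply: eq_bigr => k _; rewrite mxE. Qed.

(** Brings the power into the shape handled by [gaussian_quadratic_laplace]. *)
Lemma abs2_cdot_chan_vec x i j (f : 'cV[R[i]]_n) :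
  abs2 (cdot (chan_vec x i j) f) =
  (\sum_(k < n) (x (i, j, k, false) * complex.Re (f k 0) +
                 x (i, j, k, true) * complex.Im (f k 0))) ^+ 2 +
  (\sum_(k < n) (x (i, j, k, false) * complex.Im (f k 0) -
                 x (i, j, k, true) * complex.Re (f k 0))) ^+ 2.
Proof.
rewrite /abs2 /cdot !raddf_sum /=; congr (_ ^+ 2 + _ ^+ 2); apply: eq_bigr => k _.
  by rewrite mxE; case: (f k 0) => a b /=; ring.
by rewrite mxE; case: (f k 0) => a b /=; ring.
Qed.

Lemma Re_cnormalize_chan_vec x i j k :
  complex.Re (cnormalize (chan_vec x i j) k 0) =
  (cnorm (chan_vec x i j))^-1 * x (i, j, k, false).
Proof. by rewrite !mxE /= mul0r subr0. Qed.

Lemma Im_cnormalize_chan_vec x i j k :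
  complex.Im (cnormalize (chan_vec x i j) k 0) =
  (cnorm (chan_vec x i j))^-1 * x (i, j, k, true).
Proof. by rewrite !mxE /= mul0r addr0. Qed.

Definition desired (s : strategy) x : R :=
  match s with
  | BF => csqnorm (chan_vec x 0 0)
  | IC => csqnorm (chan_vec x 0 0) -
      abs2 (cdot (chan_vec x 0 0) (cnormalize (chan_vec x 1 0)))
  end.

Definition interference (s : strategy) x : R :=
  match s with
  | BF => abs2 (cdot (chan_vec x 0 1) (cnormalize (chan_vec x 1 1)))
  | IC => 0
  end.

Lemma SINR1E (P11 P12 : R) s1 s2 x :
  SINR1 P11 P12 s1 s2 (chan_vec x 0 0) (chan_vec x 0 1) (chan_vec x 1 0)
    (chan_vec x 1 1) =
  P11 * desired s1 x / (1 + P12 * interference s2 x).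
Proof.
rewrite /SINR1; congr (_ * _ / (1 + _ * _)).
  by case: s1; [exact: signal_BF|exact: signal_IC].
case: s2; first by [].
rewrite [precoder _ _ _]/(f_IC _ _) interference_IC /interference.
by rewrite /abs2/= expr0n addr0.
Qed.

Lemma desired_ge0 s x : 0 <= desired s x.
Proof.
case: s; first exact: csqnorm_ge0.
by rewrite /desired -signal_IC; exact: abs2_ge0.
Qed.

Lemma interference_ge0 s x : 0 <= interference s x.
Proof. by case: s => //=; exact: abs2_ge0. Qed.

Lemma measurable_csqnorm_chan_vec d (T : measurableType d)
    (Y : chan_index n -> T -> R) i j : (forall a, measurable_fun setT (Y a)) ->
  measurable_fun setT (fun w => csqnorm (chan_vec (Y ^~ w) i j)).
Proof.
move=> mY; under eq_fun do rewrite csqnorm_chan_vec.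
by apply: measurable_sum => k; apply: measurable_funD; apply: measurable_funX; exact: mY.
Qed.

Lemma measurable_abs2_cdot_chan_vec d (T : measurableType d)
    (Y : chan_index n -> T -> R) i j i' j' :
  (forall a, measurable_fun setT (Y a)) ->
  measurable_fun setT (fun w =>
    abs2 (cdot (chan_vec (Y ^~ w) i j) (cnormalize (chan_vec (Y ^~ w) i' j')))).
Proof.
move=> mY; under eq_fun do rewrite abs2_cdot_chan_vec.
have mN : measurable_fun setT (fun w => (cnorm (chan_vec (Y ^~ w) i' j'))^-1).
  apply: measurable_fun_inv; apply: measurable_fun_sqrt.
  exact: measurable_csqnorm_chan_vec.
apply: measurable_funD; apply: measurable_funX; apply: measurable_sum => k.
  apply: measurable_funD; (under eq_fun do
    rewrite ?Re_cnormalize_chan_vec ?Im_cnormalize_chan_vec);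
  apply: measurable_funM => //; apply: measurable_funM => //.
apply: measurable_funB; (under eq_fun do
    rewrite ?Re_cnormalize_chan_vec ?Im_cnormalize_chan_vec);
  apply: measurable_funM => //; apply: measurable_funM => //.
Qed.

Lemma measurable_desired s : coordinatewise_measurable (desired s).
Proof.
move=> d T Y mY; case: s => /=; first exact: measurable_csqnorm_chan_vec.
by apply: measurable_funB; [exact: measurable_csqnorm_chan_vec|
  exact: measurable_abs2_cdot_chan_vec].
Qed.

Lemma measurable_interference s : coordinatewise_measurable (interference s).
Proof.
by move=> d T Y mY; case: s => //=; exact: measurable_abs2_cdot_chan_vec.
Qed.

Lemma csqnorm_cnormalize_le1 (u : 'cV[R[i]]_n) : csqnorm (cnormalize u) <= 1.
Proof.
have [->|u0] := eqVneq u 0; last by rewrite csqnorm_cnormalize.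
rewrite /cnormalize scaler0 /csqnorm big1// => k _.
by rewrite mxE /abs2/= expr0n addr0.
Qed.
End channels.

(** * Joint Laplace transform of signal and interference *)

Section gaussian_channels.
Context (R : realType) d (T : measurableType d) (P : probability T R) (n : nat).
Context (X : chan_index n -> T -> R).
Hypothesis iidX : iid_CN P X.

(** The bound [- s <= r] keeps all denominators at least 1: any partial squared norm [q] of a
    normalised vector lies in [[0, 1]], so [1 + s + r q >= 1 + s - s q >= 1]. *)
Lemma chan_block_laplace i j i' j' (W : (chan_index n -> R) -> R) (s r : R)
    (phi := fun x => W x * expR (- (s * csqnorm (chan_vec x i j) +
       r * abs2 (cdot (chan_vec x i j) (cnormalize (chan_vec x i' j'))))))
    (psi := fun x => W x * (1 + s) ^- n *
      ((1 + s) / (1 + s + r * csqnorm (cnormalize (chan_vec x i' j'))))) :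
  (i, j) != (i', j') -> 0 <= s -> - s <= r ->
  (forall k b, invariant_at (i, j, k, b) W) -> (forall x, 0 <= W x) ->
  coordinatewise_measurable phi ->
  coordinatewise_measurable psi /\
  (\int[P]_w (phi (X ^~ w))%:E = \int[P]_w (psi (X ^~ w))%:E)%E.
Proof.
move=> ij s0 rs iW W0 mphi; have [mX lawX indepX] := iidX.
pose al k (x : chan_index n -> R) := complex.Re (cnormalize (chan_vec x i' j') k 0).
pose be k (x : chan_index n -> R) := complex.Im (cnormalize (chan_vec x i' j') k 0).
have := @gaussian_quadratic_laplace _ _ _ P _ X mX lawX indepX n
  (fun k => (i, j, k, false)) (fun k => (i, j, k, true)) _ _ _ al be W s r.
have phiE : phi = (fun x => W x * expR (- (
    s * \sum_(k < n) (x (i, j, k, false) ^+ 2 + x (i, j, k, true) ^+ 2) +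
    r * ((\sum_(k < n)
             (x (i, j, k, false) * al k x + x (i, j, k, true) * be k x)) ^+ 2 +
         (\sum_(k < n)
             (x (i, j, k, false) * be k x - x (i, j, k, true) * al k x)) ^+ 2)))).
  by apply/funext => x; rewrite /phi csqnorm_chan_vec abs2_cdot_chan_vec.
rewrite phiE in mphi *.
have -> : psi = (fun x => W x * (1 + s) ^- n *
    ((1 + s) / (1 + s + r * \sum_(k < n) (al k x ^+ 2 + be k x ^+ 2)))) by [].
apply => //.
- by move=> k l [].
- by move=> k l [].
- by move=> k l; rewrite !xpair_eqE andbF.
- by move=> l; split=> k x v; rewrite /al chan_vec_update.
- by move=> l; split=> k x v; rewrite /be chan_vec_update.
- by move: s0; lra.
- move=> m x.
  set q := \sum_(l < n | _) _.
  have q0 : 0 <= q by apply: sumr_ge0 => l _; rewrite addr_ge0 ?sqr_ge0.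
  have q1 : q <= 1.
    apply: le_trans (csqnorm_cnormalize_le1 (chan_vec x i' j')).
    rewrite /q big_mkcond; apply: ler_sum => l _; case: ifP => // _.
    exact: abs2_ge0.
  have : - s * q <= r * q by rewrite ler_wpM2r.
  have : s * q <= s * 1 by rewrite ler_wpM2l.
  lra.
Qed.

(** A zero channel forces the real part of its first entry to be [0], an event of probability zero
    since the normal law has no atoms. *)
Lemma chan_neq0_ae i j : (0 < n)%N ->
  {ae P, forall w, chan_vec (X ^~ w) i j != 0}.
Proof.
move=> n0; have [mX lawX _] := iidX.
pose a : chan_index n := (i, j, Ordinal n0, false).
exists (X a @^-1` [set 0]); split.
- by rewrite -[X in measurable X]setTI; apply: mX.
- rewrite lawX//; have /null_content_dominatesP :=
    normal_prob_dominates (0 : R) (Num.sqrt 2^-1).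
  by apply => //; exact: lebesgue_measure_set1.
- move=> w /= /negP; rewrite negbK => /eqP /matrixP /(_ (Ordinal n0) 0).
  by rewrite !mxE => -[].
Qed.

(** The number of complex dimensions left to the useful signal: cancelling one interference
    direction costs one. *)
Definition signal_dof (s : strategy) : nat := match s with BF => n | IC => n.-1 end.

(** The block of [h11] is integrated out with the direction of [h21] frozen, the interference factor
    [W] being a constant there; then the block of [h12] with the direction of [h22] frozen. All
    strategies are treated at once by setting [r] or [b'] to [0] where a term is absent. *)
Lemma joint_laplace (s1 s2 : strategy) (a b : R) : (2 <= n)%N -> 0 <= a -> 0 <= b ->
  (\int[P]_w (expR (- (b * interference s2 (X ^~ w) + a * desired s1 (X ^~ w))))%:E =
   ((1 + (if s2 is BF then b else 0))^-1 * (1 + a) ^- signal_dof s1)%:E)%E.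
Proof.
move=> n2 a0 b0; have n0 : (0 < n)%N by exact: leq_trans n2.
pose b' := if s2 is BF then b else 0.
have b'0 : 0 <= b' by rewrite /b'; case: (s2).
pose r := if s1 is IC then - a else 0.
have ar : - a <= r by rewrite /r; case: (s1) => //; rewrite oppr_le0.
pose Y (x : chan_index n -> R) :=
  abs2 (cdot (chan_vec x 0 1) (cnormalize (chan_vec x 1 1))) : R.
pose W (x : chan_index n -> R) := expR (- (b' * Y x)).
pose phi (x : chan_index n -> R) := W x * expR (- (a * csqnorm (chan_vec x 0 0) +
   r * abs2 (cdot (chan_vec x 0 0) (cnormalize (chan_vec x 1 0))))).
have phiE x : expR (- (b * interference s2 x + a * desired s1 x)) = phi x.
  have exponentE (u v w : R) : - (b * (if s2 is BF then w else 0) +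
      a * (if s1 is BF then u else u - v)) = - (b' * w) + - (a * u + r * v).
    by rewrite /b' /r; case: (s1); case: (s2); ring.
  by rewrite /phi /W -expRD -exponentE.
under eq_integral do rewrite phiE.
have mphi : coordinatewise_measurable phi.
  move=> d' T' Z mZ.
  have exponential_measurable (f1 f2 f3 : T' -> R) : measurable_fun setT f1 ->
      measurable_fun setT f2 -> measurable_fun setT f3 ->
      measurable_fun setT
        (fun w => expR (- (b' * f3 w)) * expR (- (a * f1 w + r * f2 w))).
    by move=> m1 m2 m3; solve_measurable.
  exact: exponential_measurable (measurable_csqnorm_chan_vec 0 0 mZ)
    (measurable_abs2_cdot_chan_vec 0 0 1 0 mZ) (measurable_abs2_cdot_chan_vec 0 1 1 1 mZ).
pose q i j (x : chan_index n -> R) := csqnorm (cnormalize (chan_vec x i j)).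
pose W2 (x : chan_index n -> R) := (1 + a) ^- n * ((1 + a) / (1 + a + r * q 1 0 x)).
have W2_ge0 x : 0 <= W2 x.
  have q0 : 0 <= q 1 0 x by exact: csqnorm_ge0.
  have q1 : q 1 0 x <= 1 by exact: csqnorm_cnormalize_le1.
  have : - a * q 1 0 x <= r * q 1 0 x by rewrite ler_wpM2r.
  have : a * q 1 0 x <= a * 1 by rewrite ler_wpM2l.
  move=> H1 H2; rewrite /W2; apply: mulr_ge0.
    by rewrite invr_ge0 exprn_ge0// addr_ge0.
  by apply: mulr_ge0; rewrite ?invr_ge0; lra.
have [] := @chan_block_laplace 0 0 1 0 W a r _ a0 ar _ _ mphi; first by [].
- by move=> k c x v; rewrite /W /Y !chan_vec_update.
- by move=> x; exact: expR_ge0.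
move=> mpsi ->.
have psiE : (fun x : chan_index n -> R => W x * (1 + a) ^- n *
     ((1 + a) / (1 + a + r * csqnorm (cnormalize (chan_vec x 1 0))))) =
   (fun x => W2 x * expR (- (0 * csqnorm (chan_vec x 0 1) + b' * Y x))).
  by apply/funext => x; rewrite mul0r add0r /W2 /W /q; ring.
have mphi2 : coordinatewise_measurable
    (fun x => W2 x * expR (- (0 * csqnorm (chan_vec x 0 1) + b' * Y x))).
  by rewrite -psiE; exact: mpsi.
have iW2 k c : invariant_at (0, 1, k, c) W2.
  by move=> x v; rewrite /W2 /q chan_vec_update.
have b'N : - 0 <= b' by rewrite oppr0.
have ne : ((0, 1) : 'I_2 * 'I_2) != (1, 1) by [].
have [mpsi2 intE] := @chan_block_laplace 0 1 1 1 W2 0 b' ne (lexx 0) b'N iW2 W2_ge0 mphi2.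
transitivity (\int[P]_w (W2 (X ^~ w) *
    expR (- (0 * csqnorm (chan_vec (X ^~ w) 0 1) + b' * Y (X ^~ w))))%:E)%E.
  by apply: eq_integral => w _; congr EFin; exact: (congr1 (@^~ (X ^~ w)) psiE).
rewrite intE.
have [mX _ _] := iidX.
transitivity (\int[P]_w ((1 + b')^-1 * (1 + a) ^- signal_dof s1)%:E)%E.
  apply: ae_eq_integral => //.
  - by apply/measurable_EFinP; exact: (mpsi2 _ _ X mX).
  (* Off this null set both directions have norm 1. For IC the denominator is then [1 + a - a = 1],
     and the surviving numerator [1 + a] lowers the exponent from [n] to [n.-1]. *)
  - apply: filterS2 (chan_neq0_ae 1 0 n0) (chan_neq0_ae 1 1 n0) => w h1 h2 _ /=.
    congr EFin; rewrite /W2 /q !csqnorm_cnormalize// addr0 expr1n invr1 mulr1.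
    have a1 : 1 + a != 0 by rewrite gt_eqF// ltr_wpDr.
    have b1 : 1 + b' != 0 by rewrite gt_eqF// ltr_wpDr.
    rewrite mulr1 [RHS]mulrC div1r; congr (_ * _); rewrite /r; case: (s1) => /=.
      by rewrite mul0r addr0 divff// mulr1.
    by rewrite mulr1 addrK divr1 -{1}(prednK n0) exprS invfM mulrAC mulVf// mul1r.
by rewrite integral_cst//= probability_setT mule1.
Qed.
End gaussian_channels.

(** * The four ergodic rates *)

Section rates.
Context (R : realType) d (T : measurableType d) (P : probability T R) (n : nat).
Context (X : chan_index n -> T -> R) (P11 P12 : R).
Hypotheses (n2 : (2 <= n)%N) (P11_gt0 : 0 < P11) (P12_gt0 : 0 < P12).
Hypothesis iidX : iid_CN P X.

Lemma rate1_integral (s1 s2 : strategy) :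
  rate1 P X P11 P12 s1 s2 = (((ln 2)^-1)%:E *
    \sum_(i < signal_dof n s1) \int[lebesgue_measure]_(t in `[0%R : R, +oo[)
      (P11 * expR (- t) * (1 + (if s2 is BF then P12 * t else 0))^-1 /
       (1 + P11 * t) ^+ i.+1)%:E)%E.
Proof.
have [mX _ _] := iidX.
pose S w := P11 * desired s1 (X ^~ w).
pose I w := P12 * interference s2 (X ^~ w).
have S0 w : 0 <= S w by rewrite mulr_ge0 ?desired_ge0// ltW.
have I0 w : 0 <= I w by rewrite mulr_ge0 ?interference_ge0// ltW.
have mS : measurable_fun setT S.
  by apply: measurable_funM => //; exact: measurable_desired.
have mI : measurable_fun setT I.
  by apply: measurable_funM => //; exact: measurable_interference.
have ln2 : 0 < (ln 2 : R)^-1 by rewrite invr_gt0 ln_gt0// ltr1n.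
transitivity (\int[P]_w (((ln 2)^-1)%:E * (ln (1 + S w / (1 + I w)))%:E))%E.
  apply: eq_integral => w _; rewrite -EFinM /log2 mulrC; congr (_ * ln (1 + _))%:E.
  exact: SINR1E.
rewrite ge0_integralZl//; last 3 first.
- by apply/measurable_EFinP; solve_measurable.
- by move=> w _; rewrite lee_fin ln_ge0// lerDl mulr_ge0// invr_ge0 addr_ge0.
- by rewrite lee_fin ltW.
congr (_ * _)%E.
pose h t : R := (1 + (if s2 is BF then P12 * t else 0))^-1.
apply: (@expected_ln1p_sinr _ _ _ P S I P11 h) => //.
- by rewrite /h; case: (s2); solve_measurable.
- move=> t t0; rewrite /h invr_ge0 addr_ge0//; case: (s2) => //.
  by rewrite mulr_ge0// ltW.
(* At [a = 0] the joint transform reduces to that of the interference alone. *)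
- move=> t t0; have := @joint_laplace _ _ _ P _ X iidX s1 s2 0 (t * P12) n2 (lexx 0).
  rewrite addr0 expr1n invr1 mulr1 mulr_ge0 ?(ltW P12_gt0)// => /(_ isT).
  rewrite (mulrC t P12) /h => <-.
  by apply: eq_integral => w _; congr (expR (- _))%:E; rewrite /I; ring.
- move=> t t0; have := @joint_laplace _ _ _ P _ X iidX s1 s2 (t * P11) (t * P12) n2.
  rewrite !mulr_ge0 ?(ltW P12_gt0) ?(ltW P11_gt0)// => /(_ isT isT).
  rewrite (mulrC t P12) (mulrC t P11) /h => <-.
  by apply: eq_integral => w _; congr (expR (- _))%:E; rewrite /I /S; ring.
Qed.

Lemma rate1_IC (s1 : strategy) :
  rate1 P X P11 P12 s1 IC = (R_BF P11 (signal_dof n s1))%:E.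
Proof.
rewrite rate1_integral /R_BF -mulrA EFinM mulr_sumr -sumEFin; congr (_ * _)%E.
apply: eq_bigr => i _; rewrite -integral_incgamma//.
by apply: eq_integral => t _; rewrite addr0 invr1 mulr1.
Qed.

Lemma rate1_BF (s1 : strategy) :
  rate1 P X P11 P12 s1 BF = (R_I2 P11 P12 (signal_dof n s1))%:E.
Proof.
rewrite rate1_integral /R_I2 EFinM -sumEFin; congr (_ * _)%E.
by apply: eq_bigr => i _; rewrite integral_I1.
Qed.
End rates.

Theorem theorem1 (R : realType) (d : measure_display) (T : measurableType d)
    (P : probability T R) (Nt : nat) (X : chan_index Nt -> T -> R)
    (P11 P12 : R) :
  (2 <= Nt)%N -> 0 < P11 -> 0 < P12 -> iid_CN P X ->
  [/\ rate1 P X P11 P12 BF BF = (R_I2 P11 P12 Nt)%:E,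
      rate1 P X P11 P12 BF IC = (R_BF P11 Nt)%:E,
      rate1 P X P11 P12 IC IC = (R_BF P11 Nt.-1)%:E &
      rate1 P X P11 P12 IC BF = (R_I2 P11 P12 Nt.-1)%:E].
Proof.
by move=> n2 P11_gt0 P12_gt0 iidX; rewrite !rate1_BF// !rate1_IC.
Qed.
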